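(* Let $V_1,\dots,V_k$ be free abelian groups. For $m_1,\dots,m_k\ge0$ and a Lyndon word $u\in B(m_1,\dots,m_k)$, let $\beta_u:V_1^{\otimes m_1}\otimes\dots\otimes V_k^{\otimes m_k}\to\mathrm{Lie}[V_1\oplus\dots\oplus V_k]$ be the homomorphism sending $\bigotimes_{i=1}^k\bigotimes_{j=1}^{m_i}v_i^j$ to the element obtained from the bracketed monomial $\phi(u)$ by replacing, for each $i$, the $j$-th occurrence (from the left) of the letter $c_i$ by $v_i^j$, and let $\tilde\beta_u:\mathrm{Lie}[V_1^{\otimes m_1}\otimes\dots\otimes V_k^{\otimes m_k}]\to\mathrm{Lie}[V_1\oplus\dots\oplus V_k]$ be its extension to a Lie algebra map. Then $$\bigoplus\tilde\beta_u:\bigoplus_{\substack{m_1,\dots,m_k\ge0\\ u\in B(m_1,\dots,m_k)}}\mathrm{Lie}[V_1^{\otimes m_1}\otimes\dots\otimes V_k^{\otimes m_k}]\to\mathrm{Lie}[V_1\oplus\dots\oplus V_k]$$ is an isomorphism of abelian groups.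
   Context: A Lie algebra over $\mathbb{Z}$ is an abelian group with a bilinear bracket satisfying $[u,v]=-[v,u]$ and the Jacobi identity $[u,[v,w]]+[w,[u,v]]+[v,[w,u]]=0$ (the identity $[u,u]=0$ is not imposed); $\mathrm{Lie}[V]$ is the free such Lie algebra on an abelian group $V$. $B(m_1,\dots,m_k)$ is the set of Lyndon words in letters $c_1<\dots<c_k$ with $m_i$ occurrences of $c_i$: words strictly smaller in lexicographic order than all their proper cyclic rotations. A Lyndon word $w$ of length $>1$ has a standard factorisation $w=uv$ with $u<v$ Lyndon and $u$ as long as possible; $\phi(c_i)=c_i$ and $\phi(w)=[\phi(u),\phi(v)]$ for the standard factorisation defines a bracketed monomial $\phi(w)$. *)

(* Defs.v *)
From HB Require Import structures.
From mathcomp Require Import all_boot all_algebra.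
From mathcomp Require Import freeg.

Set Implicit Arguments.
Unset Strict Implicit.
Unset Printing Implicit Defensive.

Import GRing.Theory.
Local Open Scope ring_scope.

(* Binary trees = non-associative monomials (free magma) over T.        *)
Inductive tree (T : Type) : Type :=
  | Leaf of T
  | Node of tree T & tree T.
Arguments Leaf {T}.
Arguments Node {T}.

Fixpoint tree_code (T : Type) (t : tree T) : GenTree.tree T :=
  match t with
  | Leaf x => GenTree.Leaf x
  | Node a b => GenTree.Node 0 [:: tree_code a; tree_code b]
  end.

Fixpoint tree_decode (T : Type) (g : GenTree.tree T) : option (tree T) :=
  match g with
  | GenTree.Leaf x => Some (Leaf x)
  | GenTree.Node 0 [:: a; b] =>
      match tree_decode a, tree_decode b with
      | Some a', Some b' => Some (Node a' b')
      | _, _ => None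
      end
  | _ => None
  end.

Lemma tree_codeK (T : Type) : pcancel (@tree_code T) (@tree_decode T).
Proof. by elim=> [x|a IHa b IHb] //=; rewrite IHa IHb. Qed.

HB.instance Definition _ (T : choiceType) :=
  Choice.copy (tree T) (pcan_type (@tree_codeK T)).

Fixpoint tmap (A B : Type) (f : A -> B) (t : tree A) : tree B :=
  match t with
  | Leaf x => Leaf (f x)
  | Node a b => Node (tmap f a) (tmap f b)
  end.

(* The free non-associative ring Z{Y} on a set Y: the free abelian      *)
(* group on binary trees, with the bilinear extension of Node.         *)
Notation nafree Y := {freeg (tree Y) / int}.

Definition br (Y : choiceType) (p q : nafree Y) : nafree Y :=
  \sum_(t <- dom p) \sum_(s <- dom q) << coeff t p * coeff s q *g Node t s >>.

(* The two-sided ideal of Z{Y} generated by all instances of the        *)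
(* antisymmetry and Jacobi identities.  Lie[Z^(Y)] = Z{Y} / lie_ideal  *)
(* is the free Lie ring (over Z, [u,u]=0 NOT imposed) on the free      *)
(* abelian group with basis Y.                                         *)
Inductive lie_ideal (Y : choiceType) : nafree Y -> Prop :=
  | li_anti a b : lie_ideal (br a b + br b a)
  | li_jacobi a b c :
      lie_ideal (br a (br b c) + br c (br a b) + br b (br c a))
  | li_zero : lie_ideal 0
  | li_add p q : lie_ideal p -> lie_ideal q -> lie_ideal (p + q)
  | li_opp p : lie_ideal p -> lie_ideal (- p)
  | li_brl a p : lie_ideal p -> lie_ideal (br a p)
  | li_brr p a : lie_ideal p -> lie_ideal (br p a).

Fixpoint tree_eval (Y Z : choiceType) (f : Y -> nafree Z) (t : tree Y)
  : nafree Z :=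
  match t with
  | Leaf y => f y
  | Node a b => br (tree_eval f a) (tree_eval f b)
  end.

Definition alg_ext (Y Z : choiceType) (f : Y -> nafree Z) (p : nafree Y)
  : nafree Z := fglift (tree_eval f) p.

(* Words over the ordered alphabet c_0 < ... < c_(k-1), i.e. 'I_k.     *)
Fixpoint lex_lt (k : nat) (s t : seq 'I_k) : bool :=
  match s, t with
  | [::], [::] => false
  | [::], _ :: _ => true
  | _ :: _, [::] => false
  | a :: s', b :: t' => (a < b)%N || ((a == b) && lex_lt s' t')
  end.

Definition lyndon (k : nat) (w : seq 'I_k) : bool :=
  (w != [::]) && all (fun i => lex_lt w (rot i w)) (iota 1 (size w).-1).

Definition sf_ok (k : nat) (w : seq 'I_k) (i : nat) : bool :=
  [&& (0 < i)%N, (i < size w)%N, lyndon (take i w), lyndon (drop i w)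
    & lex_lt (take i w) (drop i w)].

Definition sf_idx (k : nat) (w : seq 'I_k) : nat :=
  foldr maxn 0%N [seq i <- iota 0 (size w) | sf_ok w i].

(* phi(w) as a bracketing of w: a tree whose leaves are the positions  *)
(* (offset by [off]) of the letters of w, from left to right.          *)
Fixpoint phi_pos (k : nat) (n off : nat) (w : seq 'I_k) : tree nat :=
  match n with
  | 0 => Leaf off
  | n'.+1 =>
      if (size w <= 1)%N then Leaf off
      else let i := sf_idx w in
           Node (phi_pos n' off (take i w)) (phi_pos n' (off + i) (drop i w))
  end.

Definition phi (k : nat) (w : seq 'I_k) : tree nat := phi_pos (size w) 0 w.

(* Free abelian groups V_i with bases X_i, encoded by one choiceType X *)
(* with a colouring col : X -> 'I_k (X_i = col^-1(i)); V_1+...+V_k is   *)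
(* then free on X.  The tensor product V_1^(m_1) ... V_k^(m_k) is free  *)
(* on the tuples of basis vectors, encoded as words s over X whose      *)
(* colour word is c_1^m_1 ... c_k^m_k.                                 *)
Definition block_word (k : nat) (u : seq 'I_k) : seq 'I_k :=
  flatten [seq nseq (count_mem i u) i | i <- enum 'I_k].

Definition tensor_basis (k : nat) (X : choiceType) (col : X -> 'I_k)
  (u : seq 'I_k) := {s : seq X | map col s == block_word u}.

Definition beta_mon (k : nat) (X : choiceType) (col : X -> 'I_k)
  (u : seq 'I_k) (s : seq X) : nafree X :=
  match u, s with
  | c0 :: _, x0 :: _ =>
      let sub (p : nat) :=
        let c := nth c0 u p in
        nth x0 [seq y <- s | col y == c] (count_mem c (take p u)) in
      << tmap sub (phi u) >>
  | _, _ => 0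
  end.

Definition lyndon_word (k : nat) := {u : seq 'I_k | lyndon u}.

(* tilde beta_u : Lie[W_u] -> Lie[V], at the level of representatives. *)
Definition beta_tilde (k : nat) (X : choiceType) (col : X -> 'I_k)
  (u : lyndon_word k) (a : nafree (tensor_basis col (val u))) : nafree X :=
  alg_ext (fun y : tensor_basis col (val u) => beta_mon col (val u) (val y)) a.

Definition dsum_elt (k : nat) (X : choiceType) (col : X -> 'I_k) :=
  seq {u : lyndon_word k & nafree (tensor_basis col (val u))}.

Definition dsum_map (k : nat) (X : choiceType) (col : X -> 'I_k)
  (l : dsum_elt col) : nafree X :=
  \sum_(z <- l) @beta_tilde k X col (tag z) (tagged z).

(* Main.v *)
Require Import Defs.
From HB Require Import structures.
From mathcomp Require Import all_boot all_algebra.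
From mathcomp Require Import freeg ring zify.

(* Lazard elimination. If h is a letter of the alphabet A, then Lie[A] is
   Lie[h] + Lie[ad(h)^n g : g in A, g <> h, n >= 0]: the inverse map goes from
   Lie[A] to the semidirect product of the two summands, in which h acts on the
   second one by the derivation sending each generator g to ad(h) g. Derivations
   satisfy the Lie identities exactly, so [u,u] = 0 is never needed. Letters may be
   coloured, h standing for all the letters of one colour.

   Starting from the colours c_1 < ... < c_k, fix N and eliminate the colours of
   length at most N in increasing lexicographic order. Since the longest Lyndon
   prefix of l w (l < w Lyndon) is l exactly when w is a letter or its own left
   factor is at most l, the colours eliminated are the phi(u), u Lyndon of length
   at most N, and what remains has length larger than N. Injectivity follows by
   taking N large; surjectivity follows because elimination preserves degrees.

   All the generators that occur are trees over X, so Lie[A] is represented inside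
   the free algebra on the single set tree X by a support condition. *)

Set Implicit Arguments.
Unset Strict Implicit.
Unset Printing Implicit Defensive.

Import GRing.Theory.
Local Open Scope ring_scope.

HB.instance Definition _ (K : choiceType) (M : lmodType int) (f : K -> M) :=
  GRing.isZmodMorphism.Build {freeg K / int} M (fglift f) (lift_is_additive f).

HB.instance Definition _ (Y Z : choiceType) (f : Y -> nafree Z) :=
  GRing.isZmodMorphism.Build (nafree Y) (nafree Z) (alg_ext f)
    (lift_is_additive (tree_eval f)).

Ltac freeg_linear :=
  apply/eqP/freeg_eqP => ?; rewrite ?(coeffD, coeffN, coeff0); ring.

(** * Free nonassociative rings and their Lie ideal *)

Section Support.
Variable K : choiceType.
Implicit Types (p q : {freeg K / int}) (S T : pred K).

Lemma fglift1 (M : lmodType int) (f : K -> M) t : fglift f << t >> = f t.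
Proof. by rewrite liftU scale1r. Qed.

Definition supp S p := all S (dom p).

Lemma supp0 S : supp S 0.
Proof. by rewrite /supp dom0. Qed.

Lemma supp1 S t : supp S << t >> = S t.
Proof. by rewrite /supp domU1 /= andbT. Qed.

Lemma suppN S p : supp S p -> supp S (- p).
Proof. by move=> /allP sp; apply/allP => t; rewrite domN => /sp. Qed.

Lemma suppD S p q : supp S p -> supp S q -> supp S (p + q).
Proof.
move=> /allP sp /allP sq; apply/allP => t /domD_subset.
by rewrite mem_cat => /orP[/sp|/sq].
Qed.

Lemma suppB S p q : supp S p -> supp S q -> supp S (p - q).
Proof. by move=> sp sq; apply/suppD/suppN. Qed.

Lemma sub_supp S T p : subpred S T -> supp S p -> supp T p.
Proof. by move=> ST; apply: sub_all. Qed.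

Lemma suppI S T p : supp S p -> supp T p -> supp (predI S T) p.
Proof. by rewrite /supp all_predI => -> ->. Qed.

Lemma supp_pred0 p : supp pred0 p -> p = 0.
Proof.
by rewrite /supp; case E: (dom p) => // _; apply/eqP; rewrite -dom_eq0 E.
Qed.

Lemma suppT p : supp predT p.
Proof. exact: all_predT. Qed.

(** Closure under differences yields opposites, sums and integer multiples, hence all integer
    combinations of monomials, so linear arguments need a single additive case. *)
Lemma supp_ind S (Pr : {freeg K / int} -> Prop) :
  Pr 0 -> (forall p q, Pr p -> Pr q -> Pr (p - q)) ->
  (forall t, S t -> Pr << t >>) -> forall p, supp S p -> Pr p.
Proof.
move=> Pr0 PrB Pr1.
have PrN p : Pr p -> Pr (- p) by move=> hp; rewrite -sub0r; apply: PrB.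
have PrD p q : Pr p -> Pr q -> Pr (p + q).
  by move=> hp hq; rewrite -[q]opprK; apply: PrB => //; apply: PrN.
have Prn p n : Pr p -> Pr (p *+ n).
  by move=> hp; elim: n => [|n IHn]; rewrite ?mulr0n // mulrS; apply: PrD.
move=> p /allP sp; rewrite -[p]freeg_sumE big_seq.
apply: (big_ind Pr) => // t /sp /Pr1 Prt.
rewrite -[coeff t p]intz -freegU_mulz; case: (coeff t p) => n.
  exact: Prn.
by rewrite NegzE mulrNz; apply/PrN/Prn.
Qed.

Lemma freeg_spanW (Pr : {freeg K / int} -> Prop) :
  Pr 0 -> (forall p q, Pr p -> Pr q -> Pr (p - q)) ->
  (forall t, Pr << t >>) -> forall p, Pr p.
Proof.
move=> P0 PB P1 p; exact: (supp_ind P0 PB (fun t _ => P1 t) (suppT p)).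
Qed.

Lemma eq_supp_additive (M : zmodType) (f g : {freeg K / int} -> M) S p :
  {morph f : x y / x - y} -> {morph g : x y / x - y} ->
  (forall t, S t -> f << t >> = g << t >>) -> supp S p -> f p = g p.
Proof.
move=> fB gB fg; move: p; apply: supp_ind => [|p q|t /fg//].
  by rewrite -(subrr 0) fB gB !subrr.
by rewrite fB gB => -> ->.
Qed.

Lemma fglift_sum (M : lmodType int) (f : K -> M) p :
  fglift f p = \sum_(t <- dom p) coeff t p *: f t.
Proof.
by rewrite -{1}[p]freeg_sumE raddf_sum /=; apply: eq_bigr => t _; rewrite liftU.
Qed.

End Support.

Lemma supp_fglift (K K' : choiceType) (f : K -> {freeg K' / int}) 
    (S : pred K) (T : pred K') p :
  (forall t, S t -> supp T (f t)) -> supp S p -> supp T (fglift f p).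
Proof.
move=> fS; move: p; apply: supp_ind => [|p q hp hq|t /fS]; last by rewrite fglift1.
  by rewrite raddf0 supp0.
by rewrite raddfB; apply: suppB.
Qed.

(** * The bracket and congruence modulo the Lie ideal *)

Section Bracket.
Variable Y : choiceType.
Implicit Types (p q r : nafree Y) (S T U : pred (tree Y)).

Lemma freegUZ (K : choiceType) (c d : int) (t : K) :
  << c * d *g t >> = c *: << d *g t >>.
Proof. by apply/eqP/freeg_eqP => u; rewrite coeffZ !coeffU mulrA. Qed.

(** As an iterated linear extension the bracket is visibly additive in the outer argument; [brEr]
    exchanges the sums to treat the other one. *)
Lemma brE p q :
  br p q = fglift (fun t => fglift (fun s => << Node t s >>) q) p.
Proof.
rewrite fglift_sum; apply: eq_bigr => t _.
rewrite fglift_sum scaler_sumr; apply: eq_bigr => s _.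
by rewrite -[coeff s q in LHS]mulr1 !freegUZ.
Qed.

Lemma brEr p q :
  br p q = fglift (fun s => fglift (fun t => << Node t s >>) p) q.
Proof.
rewrite fglift_sum /br exchange_big; apply: eq_bigr => t _ /=.
rewrite fglift_sum scaler_sumr; apply: eq_bigr => s _.
by rewrite mulrC -[coeff s p in LHS]mulr1 !freegUZ.
Qed.

Lemma brBl p q r : br (p - q) r = br p r - br q r.
Proof. by rewrite !brE raddfB. Qed.
Lemma brBr p q r : br r (p - q) = br r p - br r q.
Proof. by rewrite !brEr raddfB. Qed.
Lemma brDl p q r : br (p + q) r = br p r + br q r.
Proof. by rewrite !brE raddfD. Qed.
Lemma brDr p q r : br r (p + q) = br r p + br r q.
Proof. by rewrite !brEr raddfD. Qed.
Lemma br0l p : br 0 p = 0.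
Proof. by rewrite brE raddf0. Qed.
Lemma br0r p : br p 0 = 0.
Proof. by rewrite brEr raddf0. Qed.
Lemma brNl p q : br (- p) q = - br p q.
Proof. by rewrite !brE raddfN. Qed.
Lemma brNr p q : br p (- q) = - br p q.
Proof. by rewrite !brEr raddfN. Qed.
Lemma br1 (t s : tree Y) : br << t >> << s >> = << Node t s >>.
Proof. by rewrite brE !fglift1. Qed.

Definition brlin := (brDl, brDr, brNl, brNr, br0l, br0r).

Lemma supp_br S T U p q :
  (forall s t, S s -> T t -> U (Node s t)) ->
  supp S p -> supp T q -> supp U (br p q).
Proof.
move=> STU sp sq; rewrite brE; apply: supp_fglift sp => t St.
by apply: supp_fglift sq => s Ts; rewrite supp1; apply: STU.
Qed.

Definition liemod p q := lie_ideal (p - q).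

Lemma lie_idealB p q : lie_ideal p -> lie_ideal q -> lie_ideal (p - q).
Proof. by move=> hp hq; apply/li_add/li_opp. Qed.

Lemma liemod_refl p : liemod p p.
Proof. by rewrite /liemod subrr; apply: li_zero. Qed.

Lemma liemod_sym p q : liemod p q -> liemod q p.
Proof. by move=> /li_opp; rewrite opprB. Qed.

Lemma liemod_trans q p r : liemod p q -> liemod q r -> liemod p r.
Proof. by move=> pq qr; have := li_add pq qr; rewrite /liemod addrA subrK. Qed.

Lemma liemodD p q p' q' :
  liemod p q -> liemod p' q' -> liemod (p + p') (q + q').
Proof.
by move=> h h'; have := li_add h h'; rewrite /liemod opprD addrACA.
Qed.

Lemma liemodB p q p' q' :
  liemod p q -> liemod p' q' -> liemod (p - p') (q - q').
Proof.
move=> h h'; apply: liemodD => //.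
by rewrite /liemod -opprD; apply: li_opp.
Qed.

Lemma liemod_br p q p' q' :
  liemod p q -> liemod p' q' -> liemod (br p p') (br q q').
Proof.
move=> h h'; apply: (@liemod_trans (br q p')); rewrite /liemod.
  by rewrite -brBl; apply: li_brr.
by rewrite -brBr; apply: li_brl.
Qed.

(** The Jacobi identity, corrected by antisymmetry for [p,q] and r and, inside a bracket with q, for
    p and r. *)
Lemma br_leibniz p q r :
  liemod (br p (br q r)) (br (br p q) r + br q (br p r)).
Proof.
have := li_add (li_jacobi p q r) (li_opp (li_anti (br p q) r)).
move=> /li_add /(_ (li_opp (li_brl q (li_anti p r)))).
by rewrite brDr; congr lie_ideal; freeg_linear.
Qed.

End Bracket.

(** * Algebra maps determined by the images of the generators *)

Section Extension.
Variables Y Z : choiceType.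
Implicit Types (f : Y -> nafree Z) (p q : nafree Y).

Lemma alg_ext1 f t : alg_ext f << t >> = tree_eval f t.
Proof. exact: fglift1. Qed.

Lemma alg_ext_br f p q : alg_ext f (br p q) = br (alg_ext f p) (alg_ext f q).
Proof.
elim/freeg_spanW: p => [|p p' hp hp'|t]; first by rewrite !(raddf0, br0l).
  by rewrite brBl !raddfB /= hp hp' brBl.
elim/freeg_spanW: q => [|q q' hq hq'|s]; first by rewrite !(raddf0, br0r).
  by rewrite brBr !raddfB /= hq hq' brBr.
by rewrite br1 !alg_ext1.
Qed.

Lemma alg_ext_ideal f p : lie_ideal p -> lie_ideal (alg_ext f p).
Proof.
elim=> *; rewrite ?(raddfD, raddf0, raddfN) /= ?alg_ext_br.
- exact: li_anti.
- exact: li_jacobi.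
- exact: li_zero.
- exact: li_add.
- exact: li_opp.
- exact: li_brl.
- exact: li_brr.
Qed.

End Extension.

Lemma alg_ext_comp (Y Z W : choiceType) (f : Y -> nafree Z) (g : Z -> nafree W)
    (p : nafree Y) :
  alg_ext g (alg_ext f p) = alg_ext (fun y => alg_ext g (f y)) p.
Proof.
elim/freeg_spanW: p => [|p q hp hq|t]; rewrite ?raddf0 //.
  by rewrite !raddfB /= hp hq.
rewrite !alg_ext1; elim: t => [y|a IHa b IHb] //=.
by rewrite alg_ext_br IHa IHb.
Qed.

Fixpoint tall (T : Type) (S : pred T) (t : tree T) : bool :=
  match t with
  | Leaf y => S y
  | Node a b => tall S a && tall S b
  end.

Lemma sub_tall (T : Type) (S S' : pred T) t :
  (forall y, S y -> S' y) -> tall S t -> tall S' t.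
Proof.
move=> SS'; elim: t => [y /SS'//|a IHa b IHb] /= /andP[/IHa-> /IHb->] //.
Qed.

Lemma supp_tallT (Y : choiceType) (p : nafree Y) : supp (tall predT) p.
Proof. by apply/allP => t _; elim: t => //= a -> b ->. Qed.

Lemma supp_alg_ext (Y Z : choiceType) (f : Y -> nafree Z) (S : pred Y)
    (T : pred Z) p :
  (forall y, S y -> supp (tall T) (f y)) -> supp (tall S) p ->
  supp (tall T) (alg_ext f p).
Proof.
move=> fST; apply: supp_fglift; elim=> [y /fST//|a IHa b IHb] /=.
by move=> /andP[/IHa ha /IHb]; apply: supp_br ha => s t /= -> ->.
Qed.

Lemma eq_alg_ext (Y Z : choiceType) (f g : Y -> nafree Z) (S : pred Y) p :
  (forall y, S y -> f y = g y) -> supp (tall S) p ->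
  alg_ext f p = alg_ext g p.
Proof.
move=> fg; apply: eq_supp_additive; try exact: raddfB.
move=> t; rewrite !alg_ext1; elim: t => [y /fg//|a IHa b IHb] /=.
by move=> /andP[/IHa-> /IHb->].
Qed.

Lemma alg_ext_id (Y : choiceType) (p : nafree Y) :
  alg_ext (fun y => << Leaf y >>) p = p.
Proof.
elim/freeg_spanW: p => [|p q hp hq|t]; first by rewrite raddf0.
  by rewrite raddfB /= hp hq.
by rewrite alg_ext1; elim: t => [//|a IHa b IHb] /=; rewrite IHa IHb br1.
Qed.

(** * Elimination *)

Section Action.
Variable X : choiceType.
Let Y : choiceType := tree X.
Implicit Types (x y z : nafree Y) (s t : tree Y).

(** The derivation sending a generator y to the generator [Node p y], a formal stand-in for
    [p,y]. *)
Fixpoint der_tree (p : Y) (t : tree Y) : nafree Y :=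
  match t with
  | Leaf y => << Leaf (Node p y) >>
  | Node a b => br (der_tree p a) << b >> + br << a >> (der_tree p b)
  end.

Definition der (p : Y) : nafree Y -> nafree Y := fglift (der_tree p).

HB.instance Definition _ p :=
  GRing.isZmodMorphism.Build (nafree Y) (nafree Y) (der p)
    (lift_is_additive (der_tree p)).

Lemma der1 p t : der p << t >> = der_tree p t.
Proof. exact: fglift1. Qed.

Lemma der_br p x y : der p (br x y) = br (der p x) y + br x (der p y).
Proof.
elim/freeg_spanW: x => [|x x' hx hx'|t].
- by rewrite !(br0l, raddf0) addr0.
- by rewrite !(brBl, raddfB) /= hx hx' ?brBl; freeg_linear.
elim/freeg_spanW: y => [|y y' hy hy'|s].
- by rewrite !(br0r, raddf0) addr0.
- by rewrite !(brBr, raddfB) /= hy hy' ?brBr; freeg_linear.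
by rewrite br1 !der1.
Qed.

(** Differentiating an instance of an identity gives a sum of instances with one argument
    differentiated. *)
Lemma der_ideal p x : lie_ideal x -> lie_ideal (der p x).
Proof.
elim=> [a b|a b c||a b _ ha _ hb|a _ ha|a b hb|b a hb];
  rewrite ?(raddfD, raddf0, raddfN) /= ?der_br.
- move: (li_add (li_anti (der p a) b) (li_anti a (der p b))).
  by congr lie_ideal; freeg_linear.
- rewrite !brDr.
  move: (li_add (li_add (li_jacobi (der p a) b c) (li_jacobi a (der p b) c))
                (li_jacobi a b (der p c))).
  by congr lie_ideal; freeg_linear.
- exact: li_zero.
- exact: li_add.
- exact: li_opp.
- by move=> hd; apply: li_add; apply: li_brl.
- by move=> hd; apply: li_add; apply: li_brr.
Qed.

(** Extends [der] to an action of the whole free algebra; for a representation by operators,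
    brackets must act as commutators. *)
Fixpoint act_tree (s : tree Y) : nafree Y -> nafree Y :=
  match s with
  | Leaf p => der p
  | Node a b => fun y => act_tree a (act_tree b y) - act_tree b (act_tree a y)
  end.

Definition act x y := fglift (act_tree^~ y) x.

Lemma act1 s y : act << s >> y = act_tree s y.
Proof. exact: fglift1. Qed.

Lemma actBl x x' y : act (x - x') y = act x y - act x' y.
Proof. exact: raddfB. Qed.
Lemma actDl x x' y : act (x + x') y = act x y + act x' y.
Proof. exact: raddfD. Qed.
Lemma actNl x y : act (- x) y = - act x y.
Proof. exact: raddfN. Qed.
Lemma act0l y : act 0 y = 0.
Proof. exact: raddf0. Qed.

Lemma act_treeB s : {morph act_tree s : y y' / y - y'}.
Proof.
elim: s => [p|a IHa b IHb] y y' /=; first exact: raddfB.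
by rewrite IHa IHb IHa IHb; freeg_linear.
Qed.

Lemma actBr x y y' : act x (y - y') = act x y - act x y'.
Proof.
elim/freeg_spanW: x => [|x x' hx hx'|s]; first by rewrite !act0l subr0.
  by rewrite !actBl hx hx'; freeg_linear.
by rewrite !act1 act_treeB.
Qed.

Lemma act0r x : act x 0 = 0.
Proof. by rewrite -[X in act _ X](subrr 0) actBr subrr. Qed.
Lemma actNr x y : act x (- y) = - act x y.
Proof. by rewrite -[X in act _ X]sub0r actBr act0r sub0r. Qed.
Lemma actDr x y y' : act x (y + y') = act x y + act x y'.
Proof. by rewrite -[X in _ + X]opprK actBr actNr opprK. Qed.

Definition actlin := (actDl, actDr, actNl, actNr, act0l, act0r).

Lemma act_brl x x' y : act (br x x') y = act x (act x' y) - act x' (act x y).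
Proof.
elim/freeg_spanW: x => [|x z hx hz|s].
- by rewrite br0l !act0l act0r subr0.
- by rewrite brBl !actBl hx hz actBr; freeg_linear.
elim/freeg_spanW: x' => [|x z hx hz|t].
- by rewrite br0r !act0l act0r subr0.
- by rewrite brBr !actBl hx hz actBr; freeg_linear.
by rewrite br1 !act1.
Qed.

Lemma act_brr x y y' : act x (br y y') = br (act x y) y' + br y (act x y').
Proof.
elim/freeg_spanW: x => [|x x' hx hx'|s]; first by rewrite !act0l br0l br0r addr0.
  by rewrite !actBl hx hx' brBl brBr; freeg_linear.
rewrite !act1; elim: s y y' => [p|a IHa b IHb] y y' /=; first exact: der_br.
have actD c : {morph act_tree c : u v / u + v} by move=> u v; rewrite -!act1 actDr.
rewrite IHa IHb !actD !IHa !IHb brBl brBr; freeg_linear.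
Qed.

(** Commutators of operators satisfy antisymmetry and Jacobi exactly, so the ideal acts by zero and
    not merely into the ideal. This makes [sbr] compatible with [sideal]. *)
Lemma act_ideall x y : lie_ideal x -> act x y = 0.
Proof.
move=> hx; elim: hx y => [a b|a b c||a b _ ha _ hb|a _ ha|a b _ hb|b a _ hb] y;
  rewrite ?actlin ?act_brl ?actlin ?act_brl ?actlin ?ha ?hb ?actlin ?subr0 ?addr0;
  freeg_linear.
Qed.

Lemma act_idealr x y : lie_ideal y -> lie_ideal (act x y).
Proof.
elim/freeg_spanW: x => [|x x' hx hx'|s] hy; first by rewrite act0l; apply: li_zero.
  by rewrite actBl; apply: lie_idealB; [apply: hx|apply: hx'].
rewrite act1; elim: s y hy => [p|a IHa b IHb] y hy /=; first exact: der_ideal.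
by apply: lie_idealB; [apply/IHa/IHb|apply/IHb/IHa].
Qed.

(* The bracket of the semidirect product of Lie[Y] acting on Lie[Y]; it is only
   Lie modulo [lie_ideal] componentwise. *)
Definition sbr (u v : nafree Y * nafree Y) : nafree Y * nafree Y :=
  (br u.1 v.1, br u.2 v.2 + act u.1 v.2 - act v.1 u.2).

Definition sideal (u : nafree Y * nafree Y) := lie_ideal u.1 /\ lie_ideal u.2.

Lemma sbrBl u u' v : sbr (u - u') v = sbr u v - sbr u' v.
Proof.
case: u u' v => [a x] [b y] [c z]; rewrite /sbr /=.
by congr pair => /=; rewrite ?brlin ?actlin; freeg_linear.
Qed.

Lemma sbrBr u v v' : sbr u (v - v') = sbr u v - sbr u v'.
Proof.
case: u v v' => [a x] [b y] [c z]; rewrite /sbr /=.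
by congr pair => /=; rewrite ?brlin ?actlin; freeg_linear.
Qed.

Lemma sbr0l v : sbr 0 v = 0.
Proof. by rewrite -[X in sbr X _](subrr 0) sbrBl subrr. Qed.
Lemma sbr0r v : sbr v 0 = 0.
Proof. by rewrite -[X in sbr _ X](subrr 0) sbrBr subrr. Qed.

Lemma sideal_anti u v : sideal (sbr u v + sbr v u).
Proof.
case: u v => [a x] [b y]; split; first exact: li_anti.
by move: (li_anti x y); congr lie_ideal => /=; freeg_linear.
Qed.

Lemma sideal_jacobi u v w :
  sideal (sbr u (sbr v w) + sbr w (sbr u v) + sbr v (sbr w u)).
Proof.
case: u v w => [a x] [b y] [c z]; split; first exact: li_jacobi.
(* In the second component the pure action terms cancel exactly; the rest is one Jacobi instance and
   three antisymmetry instances pairing a second component with an acted one. *)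
move: (li_add (li_add (li_add (li_jacobi x y z) (li_anti x (act b z)))
   (li_anti z (act a y))) (li_anti y (act c x))).
congr lie_ideal => /=; rewrite ?brlin ?actlin ?act_brl ?act_brr ?brlin.
freeg_linear.
Qed.

Lemma sideal_brl u v : sideal v -> sideal (sbr u v).
Proof.
case: u v => [a x] [b y] [/= hb hy]; split=> /=; first exact: li_brl.
rewrite (act_ideall x hb) subr0.
by apply: li_add; [apply: li_brl|apply: act_idealr].
Qed.

Lemma sideal_brr u v : sideal u -> sideal (sbr u v).
Proof.
case: u v => [a x] [b y] [/= hb hy]; split=> /=; first exact: li_brr.
rewrite (act_ideall y hb) addr0.
by apply: li_add; [apply: li_brr|apply/li_opp/act_idealr].
Qed.

(** * Splitting off the letters of [P] *)

Section Elimination.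
Variables P A : pred Y.
Hypothesis subPA : subpred P A.
(** Keeps the letters created by the elimination apart from those of [A], so that [eflat] expands
    them. *)
Hypothesis nodeA : forall a b, P a -> A (Node a b) = false.

(** The letters ad(p_1) ... ad(p_n) g, with p_i in [P] and g in [A] outside [P], encoded as right
    combs. *)
Fixpoint elim_alph (t : Y) : bool :=
  (A t && ~~ P t) ||
  (if t is Node a b then P a && elim_alph b else false).

(** Expands a new letter into a bracket of old ones. The final 0 is a default value, never reached
    from a letter of either alphabet. *)
Fixpoint eflat (t : Y) : nafree Y :=
  if A t then << Leaf t >>
  else if t is Node a b then br << Leaf a >> (eflat b) else 0.

(** The algebra map to the semidirect product that inverts the expansion by [eflat], modulo the
    ideals. *)
Fixpoint split_tree (t : tree Y) : nafree Y * nafree Y :=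
  match t with
  | Leaf y => if P y then (<< Leaf y >>, 0) else (0, << Leaf y >>)
  | Node a b => sbr (split_tree a) (split_tree b)
  end.

Definition lsplit : nafree Y -> nafree Y * nafree Y := fglift split_tree.

HB.instance Definition _ :=
  GRing.isZmodMorphism.Build (nafree Y) (nafree Y * nafree Y)%type lsplit
    (lift_is_additive split_tree).

Lemma lsplit1 t : lsplit << t >> = split_tree t.
Proof. exact: fglift1. Qed.

Lemma lsplit_br x y : lsplit (br x y) = sbr (lsplit x) (lsplit y).
Proof.
elim/freeg_spanW: x => [|x x' hx hx'|t].
- by rewrite br0l !raddf0 sbr0l.
- by rewrite brBl !raddfB /= hx hx' sbrBl.
elim/freeg_spanW: y => [|y y' hy hy'|s].
- by rewrite br0r !raddf0 sbr0r.
- by rewrite brBr !raddfB /= hy hy' sbrBr.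
by rewrite br1 !lsplit1.
Qed.

Lemma lsplit_ideal x : lie_ideal x -> sideal (lsplit x).
Proof.
elim=> [a b|a b c||a b _ [? ?] _ [? ?]|a _ [? ?]|a b _ hb|b a _ hb];
  rewrite ?(raddfD, raddf0, raddfN) /= ?lsplit_br.
- exact: sideal_anti.
- exact: sideal_jacobi.
- by split; apply: li_zero.
- by split; apply: li_add.
- by split; apply: li_opp.
- exact: sideal_brl.
- exact: sideal_brr.
Qed.

Lemma eflat_old (t : Y) : A t -> eflat t = << Leaf t >>.
Proof. by case: t => [x|a b] /= ->. Qed.

Lemma eflat_node a b : P a -> eflat (Node a b) = br << Leaf a >> (eflat b).
Proof. by move=> Pa /=; rewrite nodeA. Qed.

Lemma elim_alphP (t : Y) : elim_alph t ->
  (A t /\ ~~ P t) \/ exists a b, [/\ t = Node a b, P a & elim_alph b].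
Proof.
case: t => [x|a b] /=; first by rewrite orbF => /andP; left.
by case/orP=> /andP[]; [left|right; exists a, b].
Qed.

Lemma elim_alph_ind (Pr : Y -> Prop) :
  (forall t : Y, A t -> ~~ P t -> Pr t) ->
  (forall a b, P a -> elim_alph b -> Pr b -> Pr (Node a b)) ->
  forall t : Y, elim_alph t -> Pr t.
Proof.
move=> h1 h2; elim=> [x|a _ b IHb] /elim_alphP [[? ?]|[a' [b' []]]] //;
  try exact: h1.
by case=> <- <- Pa Eb; apply: h2 => //; apply: IHb.
Qed.

Lemma elim_alph_node a b : P a -> elim_alph b -> elim_alph (Node a b).
Proof. by move=> /= -> ->; rewrite orbT. Qed.

(** The splitting turns bracketing with a letter [a] of [P] into [der a], which recreates the letter
    [Node a b]. *)
Lemma lsplit_eflat (t : Y) : elim_alph t -> lsplit (eflat t) = (0, << Leaf t >>).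
Proof.
move: t; apply: elim_alph_ind => [t At nPt|a b Pa _ IHb].
  by rewrite eflat_old // lsplit1 /= (negbTE nPt).
rewrite eflat_node // lsplit_br IHb lsplit1 /= Pa /sbr /= !(br0l, br0r) act0l.
by rewrite add0r subr0 act1 /= der1.
Qed.

Lemma lsplit_ext_old x : supp (tall P) x -> lsplit (alg_ext eflat x) = (x, 0).
Proof.
move: x; apply: supp_ind => [|x y hx hy|t].
- by rewrite !raddf0.
- by rewrite !raddfB /= hx hy; congr pair => /=; rewrite subr0.
rewrite alg_ext1; elim: t => [y|a IHa b IHb] /= Pt.
  by rewrite eflat_old ?subPA // lsplit1 /= Pt.
case/andP: Pt => /IHa ha /IHb hb.
by rewrite lsplit_br ha hb /sbr /= br1 br0l !act0r addr0 subr0.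
Qed.

Lemma lsplit_ext_new y :
  supp (tall elim_alph) y -> lsplit (alg_ext eflat y) = (0, y).
Proof.
move: y; apply: supp_ind => [|x y hx hy|t].
- by rewrite !raddf0.
- by rewrite !raddfB /= hx hy; congr pair => /=; rewrite subr0.
rewrite alg_ext1; elim: t => [y|a IHa b IHb] /= Pt; first exact: lsplit_eflat.
case/andP: Pt => /IHa ha /IHb hb.
by rewrite lsplit_br ha hb /sbr /= br1 br0l !act0l addr0 subr0.
Qed.

(** The splitting preserves the ideals and is a left inverse of the expansion on each summand, so it
    recovers x and y. *)
Theorem elimination_inj x y :
  supp (tall P) x -> supp (tall elim_alph) y ->
  lie_ideal (alg_ext eflat (x + y)) -> lie_ideal x /\ lie_ideal y.
Proof.
move=> sx sy /lsplit_ideal; rewrite !raddfD /= lsplit_ext_old //.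
by rewrite lsplit_ext_new //; case=> /=; rewrite addr0 add0r.
Qed.

Lemma supp_act_gen (S T U : pred (tree Y)) x y :
  (forall s z, S s -> supp T z -> supp U (act_tree s z)) ->
  supp S x -> supp T y -> supp U (act x y).
Proof. by move=> h sx sy; apply: supp_fglift sx => s /h; apply. Qed.

Lemma supp_act x y : supp (tall P) x -> supp (tall elim_alph) y ->
  supp (tall elim_alph) (act x y).
Proof.
apply: supp_act_gen; elim=> [p|a IHa b IHb] z /=.
  move=> Pp; apply: supp_fglift; elim=> [q|a IHa b IHb] /=.
    by rewrite supp1 => /=; rewrite Pp orbC => ->.
  case/andP=> ha hb; apply: suppD.
    by apply: supp_br (IHa ha) _; last rewrite supp1; try exact: hb; move=> s t /= -> ->.
  by apply: supp_br _ (IHb hb); last rewrite supp1; try exact: ha; move=> s t /= -> ->.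
by case/andP=> ha hb hz; apply: suppB; [apply/IHa/IHb|apply/IHb/IHa].
Qed.

Lemma supp_lsplit z : supp (tall A) z ->
  supp (tall P) (lsplit z).1 /\ supp (tall elim_alph) (lsplit z).2.
Proof.
move: z; apply: supp_ind => [|x y [? ?] [? ?]|t].
- by rewrite raddf0 !supp0.
- by rewrite raddfB; split; apply: suppB.
rewrite lsplit1; elim: t => [y|a IHa b IHb] /=.
  case: ifP => Py Ay; rewrite /= !(supp0, supp1) //=; split=> //.
  by case: y Ay Py => [x|a b] /= -> ->.
case/andP=> /IHa[a1 a2] /IHb[b1 b2]; split.
  by apply: supp_br a1 b1 => s t /= -> ->.
apply: suppB; last exact: supp_act.
by apply: suppD; last exact: supp_act; apply: supp_br a2 b2 => s t /= -> ->.
Qed.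

(* Inside Lie[A], the derivation [der p] becomes the inner one [ad p]. *)
Lemma ext_act x y : supp (tall P) x -> supp (tall elim_alph) y ->
  liemod (alg_ext eflat (act x y)) (br (alg_ext eflat x) (alg_ext eflat y)).
Proof.
move=> + sy; move: x; apply: supp_ind => [|x x' hx hx'|s].
- by rewrite act0l raddf0 br0l; apply: liemod_refl.
- by rewrite actBl !raddfB /= brBl; apply: liemodB.
rewrite act1; elim: s y sy => [p|a IHa b IHb] y sy /=.
  move=> Pp; rewrite alg_ext1 /= eflat_old ?subPA //.
  move: y sy; apply: supp_ind => [|y y' hy hy'|t].
  - by rewrite !raddf0 br0r; apply: liemod_refl.
  - by rewrite !raddfB /= brBr; apply: liemodB.
  rewrite der1; elim: t => [q|a IHa b IHb] /=.
    by move=> _; rewrite !alg_ext1 /= nodeA //; apply: liemod_refl.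
  case/andP=> /IHa ha /IHb hb.
  (* Both [der p] and ad(p) obey the Leibniz rule, so agreement on letters propagates to
     brackets. *)
  rewrite raddfD /= !alg_ext_br -!br1 !alg_ext_br.
  apply: liemod_trans (liemod_sym (br_leibniz _ _ _)).
  by apply: liemodD; apply: liemod_br => //; apply: liemod_refl.
case/andP=> Pa Pb; rewrite -br1 raddfB /= alg_ext_br.
have sact c : tall P c -> supp (tall elim_alph) (act_tree c y).
  by move=> Pc; rewrite -act1; apply: supp_act => //; rewrite supp1.
set a' := alg_ext eflat << a >>; set b' := alg_ext eflat << b >>.
apply: (@liemod_trans _ (br a' (br b' (alg_ext eflat y))
                         - br b' (br a' (alg_ext eflat y)))).
  apply: liemodB.
    apply: liemod_trans (IHa _ (sact b Pb) Pa) _.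
    by apply: liemod_br (liemod_refl _) _; apply: IHb.
  apply: liemod_trans (IHb _ (sact a Pa) Pb) _.
  by apply: liemod_br (liemod_refl _) _; apply: IHa.
(* By Leibniz, ad of a bracket is the commutator of the two ads. *)
have := br_leibniz a' b' (alg_ext eflat y); rewrite /liemod.
by congr lie_ideal; freeg_linear.
Qed.

Theorem elimination_surj z : supp (tall A) z ->
  liemod (alg_ext eflat ((lsplit z).1 + (lsplit z).2)) z.
Proof.
move: z; apply: supp_ind => [|x y hx hy|t].
- by rewrite raddf0 addr0 raddf0; apply: liemod_refl.
- rewrite raddfB /= (_ : _ + _ = ((lsplit x).1 + (lsplit x).2)
        - ((lsplit y).1 + (lsplit y).2)); last by freeg_linear.
  by rewrite raddfB; apply: liemodB.
elim: t => [y|a IHa b IHb] /=.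
  rewrite lsplit1 /= => Ay; case: ifP => Py; rewrite /= ?addr0 ?add0r alg_ext1 /=.
    by rewrite eflat_old //; apply: liemod_refl.
  by rewrite eflat_old //; apply: liemod_refl.
case/andP=> Aa Ab.
have [a1 a2] := supp_lsplit (eq_ind_r is_true Aa (supp1 _ a)).
have [b1 b2] := supp_lsplit (eq_ind_r is_true Ab (supp1 _ b)).
move: (IHa Aa) (IHb Ab) a1 a2 b1 b2; rewrite -br1 lsplit_br.
case: (lsplit << a >>) (lsplit << b >>) => [x y] [x' y'] /= ha hb sx sy sx' sy'.
apply: liemod_trans (liemod_br ha hb).
have ea := ext_act sx sy'; have eb := ext_act sx' sy.
rewrite !raddfD raddfN /= !alg_ext_br !brDl !brDr.
set X1 := alg_ext _ x in ea eb *; set X2 := alg_ext _ x' in ea eb *.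
set Y1 := alg_ext _ y in ea eb *; set Y2 := alg_ext _ y' in ea eb *.
(* [ext_act] produces the two mixed brackets, the second as -[X2,Y1]; antisymmetry turns it into
   [Y1,X2]. *)
have := li_add (liemodB ea eb) (li_opp (li_anti X2 Y1)).
by rewrite /liemod; congr lie_ideal; freeg_linear.
Qed.

End Elimination.
End Action.

(** * Evaluation of nested trees and the grading by leaves *)

Section Flatten.
Variable X : choiceType.
Let Y : choiceType := tree X.

(** Grafts each letter, itself a tree over [X], into the outer tree: the multiplication of the free
    magma monad, extended linearly. *)
Definition flat : nafree Y -> nafree X := alg_ext (fun t : Y => << t >>).

HB.instance Definition _ :=
  GRing.isZmodMorphism.Build (nafree Y) (nafree X) flat
    (lift_is_additive (tree_eval (fun t : Y => << t >>))).

Definition unflat : nafree X -> nafree Y :=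
  alg_ext (fun x : X => << Leaf (Leaf x) >>).

(** Expanding a letter does not change the tree over [X] that it denotes, so all stages can be
    compared through [flat]. *)
Lemma flat_eflat (P A : pred Y) (S : pred Y) z :
  (forall a b, P a -> A (Node a b) = false) ->
  (forall t, S t -> A t || elim_alph P A t) ->
  supp (tall S) z -> flat (alg_ext (eflat A) z) = flat z.
Proof.
move=> nodeA SA; rewrite /flat alg_ext_comp; apply: eq_alg_ext => t /SA.
case/orP=> [At|]; first by rewrite eflat_old // alg_ext1.
move: t; apply: elim_alph_ind => [t At _|a b Pa _ IHb].
  by rewrite eflat_old // alg_ext1.
by rewrite (eflat_node nodeA) // alg_ext_br IHb alg_ext1 br1.
Qed.

Lemma supp_eflat (P A : pred Y) (S : pred Y) z :
  (forall a b, P a -> A (Node a b) = false) -> subpred P A ->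
  (forall t, S t -> A t || elim_alph P A t) ->
  supp (tall S) z -> supp (tall A) (alg_ext (eflat A) z).
Proof.
move=> nodeA subPA SA; apply: supp_alg_ext => t /SA.
case/orP=> [At|]; first by rewrite eflat_old // supp1.
move: t; apply: elim_alph_ind => [t At _|a b Pa _ IHb].
  by rewrite eflat_old // supp1.
rewrite (eflat_node nodeA) //.
apply: (supp_br (S := tall A)) IHb; first by move=> s t /= -> ->.
by rewrite supp1; apply: subPA.
Qed.

Lemma unflat_eval t :
  tree_eval (fun x : X => << Leaf (Leaf x) >>) t = << tmap (@Leaf X) t >> :> nafree Y.
Proof. by elim: t => [//|a IHa b IHb] /=; rewrite IHa IHb br1. Qed.

Lemma unflatK q : flat (unflat q) = q.
Proof.
rewrite /flat /unflat alg_ext_comp -[RHS]alg_ext_id.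
by apply: eq_alg_ext (supp_tallT q) => x _; rewrite alg_ext1.
Qed.

Definition is_leaf (T : Type) (t : tree T) := if t is Leaf _ then true else false.

Lemma flatK z : supp (tall (@is_leaf X)) z -> unflat (flat z) = z.
Proof.
move=> sz; rewrite /flat /unflat alg_ext_comp -[RHS]alg_ext_id.
by apply: eq_alg_ext sz => -[] // x _; rewrite alg_ext1.
Qed.

Fixpoint nleaves (T : Type) (t : tree T) : nat :=
  if t is Node a b then (nleaves a + nleaves b)%N else 1%N.

(** The degree after flattening: letters count with their own number of leaves. Elimination
    preserves this grading. *)
Fixpoint weight (t : tree Y) : nat :=
  match t with
  | Leaf y => nleaves y
  | Node a b => (weight a + weight b)%N
  end.

Definition homog (n : nat) : nafree Y -> bool := supp (fun t => weight t == n).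

Lemma homog_br m n x y : homog m x -> homog n y -> homog (m + n)%N (br x y).
Proof. by apply: supp_br => s t /= /eqP-> /eqP->. Qed.

Lemma homog_act m n x y : homog m x -> homog n y -> homog (m + n)%N (act x y).
Proof.
apply: supp_act_gen => s z /eqP <- {m x y}; elim: s n z => [p|a IHa b IHb] n z /=.
  move: z; apply: supp_ind => [|x y hx hy|t /eqP <-].
  - by rewrite raddf0; apply: supp0.
  - by rewrite raddfB; apply: suppB.
  rewrite der1; elim: t => [q|a IHa b IHb] /=; first by rewrite supp1.
  have w1 c : homog (weight c) << c >> by rewrite /homog supp1.
  apply: suppD; first by rewrite addnA; apply: homog_br.
  by rewrite addnCA; apply: homog_br.
move=> hz; apply: suppB; first by rewrite -addnA; apply/IHa/IHb.
by rewrite -addnA addnCA; apply/IHb/IHa.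
Qed.

Lemma homog_lsplit P n z :
  homog n z -> homog n (lsplit P z).1 /\ homog n (lsplit P z).2.
Proof.
move: z; apply: supp_ind => [|x y [? ?] [? ?]|t /eqP <- {n}].
- by rewrite raddf0; split; apply: supp0.
- by rewrite raddfB; split; apply: suppB.
rewrite lsplit1; elim: t => [y|a [a1 a2] b [b1 b2]] /=.
  by case: ifP => _; rewrite /homog /= !(supp0, supp1).
split; first exact: homog_br.
apply: suppB; first by apply: suppD; [apply: homog_br|apply: homog_act].
by rewrite addnC; apply: homog_act.
Qed.

Lemma homog_unflat n q :
  supp (fun t => nleaves t == n) q -> homog n (unflat q).
Proof.
apply: supp_fglift => t /eqP <-; rewrite unflat_eval supp1.
by apply/eqP; elim: t => //= a -> b ->.
Qed.

Lemma supp_unflat q : supp (tall (@is_leaf X)) (unflat q).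
Proof.
apply: supp_fglift (suppT q) => t _; rewrite unflat_eval supp1.
by elim: t => //= a -> b ->.
Qed.

End Flatten.

(** * Iterated elimination *)

Section Stages.
Variables (C X : choiceType) (col : X -> C).
Let Y : choiceType := tree X.
Implicit Types (H : seq (tree C)) (h : tree C).

(* The alphabet left after the elements of H have been eliminated, the head
   of H being the last one. *)
Fixpoint alph H : pred (tree C) :=
  if H is h :: H' then elim_alph (pred1 h) (alph H') else @is_leaf C.

Fixpoint lazard H : bool :=
  if H is h :: H' then [&& alph H' h, h \notin H' & lazard H'] else true.

Definition coltree (S : pred (tree C)) : pred Y := fun t => S (tmap col t).

Lemma elim_alph_col (P A : pred (tree C)) t :
  elim_alph (coltree P) (coltree A) t = elim_alph P A (tmap col t).
Proof. by elim: t => [x|a IHa b IHb] //=; rewrite IHb. Qed.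

(** A node enters the alphabet only when its left subtree is eliminated. For a fresh [h] this yields
    the hypothesis [nodeA] of the next elimination. *)
Lemma alph_node H a b : alph H (Node a b) -> a \in H.
Proof.
elim: H => [//|h H IHH] /= /orP[/andP[/IHH aH _]|/andP[/eqP-> _]].
  by rewrite in_cons aH orbT.
exact: mem_head.
Qed.

Lemma colour_node H h : h \notin H ->
  forall a b : Y, coltree (pred1 h) a -> coltree (alph H) (Node a b) = false.
Proof.
move=> hH a b /eqP ha; rewrite /coltree /= ha.
by apply/negP => /alph_node; rewrite (negbTE hH).
Qed.

Lemma colour_sub H h : alph H h -> subpred (coltree (pred1 h)) (coltree (alph H)).
Proof. by move=> Hh t /eqP; rewrite /coltree => ->. Qed.

Lemma supp_coltree_cons H h z :
  supp (tall (coltree (alph (h :: H)))) z =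
  supp (tall (elim_alph (coltree (pred1 h)) (coltree (alph H)))) z.
Proof.
apply: eq_all; elim=> [y|a IHa b IHb] //=; last by rewrite IHa IHb.
by rewrite elim_alph_col.
Qed.

Theorem stage_inj H (x : tree C -> nafree Y) (z : nafree Y) :
  lazard H ->
  (forall h, h \in H -> supp (tall (coltree (pred1 h))) (x h)) ->
  supp (tall (coltree (alph H))) z ->
  lie_ideal (flat (\sum_(h <- H) x h + z)) ->
  (forall h, h \in H -> lie_ideal (x h)) /\ lie_ideal z.
Proof.
elim: H z => [|h H IHH] z /=.
  (* Before any elimination all letters are leaves, and there the algebra map [unflat] inverts
     [flat]. *)
  move=> _ _ sz; rewrite big_nil add0r => /alg_ext_ideal hz; split=> //.
  rewrite -[z]flatK; first exact: hz.
  by apply: sub_supp sz => t; apply: sub_tall => -[].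
case/and3P=> Hh hH lH sx sz.
set P := coltree (pred1 h); set A := coltree (alph H).
have nodeA : forall a b, P a -> A (Node a b) = false by apply: colour_node.
have subPA : subpred P A by apply: colour_sub.
have sxh : supp (tall P) (x h) by apply/sx/mem_head.
move: sz; rewrite [X in is_true X -> _]supp_coltree_cons -/P -/A => sz.
rewrite big_cons -addrA [x h + _]addrCA.
(* The last elimination is undone first: both summands are expanded over the previous alphabet,
   where the induction hypothesis applies. *)
set z' := alg_ext (eflat A) (x h + z) => hI.
have sA (S : pred Y) : (forall t, S t -> A t || elim_alph P A t) ->
    forall y, supp (tall S) y -> supp (tall A) (alg_ext (eflat A) y).
  by move=> SA y; apply: (supp_eflat nodeA subPA SA).
have SP t : P t -> A t || elim_alph P A t by move=> /subPA ->.
have SE t : elim_alph P A t -> A t || elim_alph P A t by move=> ->; rewrite orbT.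
have [|||xI zI] := IHH z' lH.
- by move=> h' hh'; apply: sx; rewrite in_cons hh' orbT.
- by rewrite /z' raddfD; apply: suppD; [apply: sA sxh|apply: sA sz].
- rewrite raddfD /= /z' raddfD raddfD /=.
  rewrite (flat_eflat nodeA SP sxh) (flat_eflat nodeA SE sz).
  by rewrite -!raddfD.
have [hxI hzI] := elimination_inj subPA nodeA sxh sz zI.
by split=> // h'; rewrite in_cons => /predU1P[->//|/xI].
Qed.

Theorem stage_surj H n (q : nafree X) :
  lazard H -> supp (fun t => nleaves t == n) q ->
  exists (x : tree C -> nafree Y) (z : nafree Y),
  [/\ forall h, h \in H -> supp (tall (coltree (pred1 h))) (x h),
      supp (tall (coltree (alph H))) z, homog n z &
      liemod (flat (\sum_(h <- H) x h + z)) q].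
Proof.
move=> + sq; elim: H => [_|h H IHH] /=.
  exists (fun=> 0), (unflat q); rewrite big_nil add0r; split=> //.
  - by apply: sub_supp (supp_unflat q) => t; apply: sub_tall => -[].
  - exact: homog_unflat.
  by rewrite unflatK; apply: liemod_refl.
case/and3P=> Hh hH /IHH {IHH} [x [z [sx sz hz xzq]]].
set P := coltree (pred1 h); set A := coltree (alph H).
have nodeA : forall a b, P a -> A (Node a b) = false by apply: colour_node.
have subPA : subpred P A by apply: colour_sub.
have [s1 s2] := supp_lsplit P sz.
have [h1 h2] := homog_lsplit P hz.
(* The remainder splits into its part over the letters of colour [h] and a new remainder; as [h] is
   not in [H], earlier components are unchanged. *)
exists (fun h' => if h' == h then (lsplit P z).1 else x h'), (lsplit P z).2.
split=> //.
- move=> h'; rewrite in_cons; case: eqP => [-> //|_]; exact: sx.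
- by rewrite [X in is_true X]supp_coltree_cons.
rewrite big_cons eqxx -addrA addrCA.
rewrite [X in X + _](eq_big_seq x); last first.
  by move=> h' h'H; case: eqP => // eh; rewrite -eh h'H in hH.
apply: liemod_trans xzq; rewrite !raddfD /=.
apply: liemodD; first exact: liemod_refl.
have SP t : P t -> A t || elim_alph P A t by move=> /subPA ->.
have SE t : elim_alph P A t -> A t || elim_alph P A t by move=> ->; rewrite orbT.
rewrite -(flat_eflat nodeA SP s1) -(flat_eflat nodeA SE s2) -!raddfD /liemod -raddfB /=.
exact/alg_ext_ideal/elimination_surj.
Qed.

End Stages.

(** * Lyndon words *)

Section LyndonWords.
Local Open Scope nat_scope.
Variable k : nat.
Implicit Types (s t u v w x y z l p q r : seq 'I_k).

Lemma nonnil_size s : (s != [::]) = (0 < size s).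
Proof. by case: s. Qed.

Lemma lex_irr s : lex_lt s s = false.
Proof. by elim: s => //= a s ->; rewrite ltnn eqxx. Qed.

Lemma lex_trans : transitive (@lex_lt k).
Proof.
move=> t s u; elim: t s u => [|b t IHt] [|a s] [|c u] //=.
case/orP=> [ab|/andP[/eqP-> st]] /orP[bc|/andP[/eqP<- tu]].
- by rewrite (ltn_trans ab bc).
- by rewrite ab.
- by rewrite bc.
by rewrite eqxx (IHt _ _ st tu) orbT.
Qed.

Lemma lex_total s t : s != t -> lex_lt s t || lex_lt t s.
Proof.
elim: s t => [|a s IHs] [|b t] //=; rewrite eqseq_cons.
have [ab|ba|/val_inj->] := ltngtP a b; rewrite ?eqxx ?orbT //=.
by move=> /IHs.
Qed.

Lemma lex_cat2l p s t : lex_lt (p ++ s) (p ++ t) = lex_lt s t.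
Proof. by elim: p => //= a p ->; rewrite ltnn eqxx. Qed.

Lemma lex_prefix s t : t != [::] -> lex_lt s (s ++ t).
Proof. by move=> tN0; rewrite -[X in lex_lt X _]cats0 lex_cat2l; case: t tN0. Qed.

Lemma lexP s t : lex_lt s t ->
  (exists2 z, t = s ++ z & z != [::]) \/ forall x y, lex_lt (s ++ x) (t ++ y).
Proof.
elim: s t => [|a s IHs] [|b t] //=; first by left; exists (b :: t).
case/orP=> [ab|/andP[/eqP<- /IHs[[z -> zN0]|h]]].
- by right=> x y; rewrite ab.
- by left; exists z.
by right=> x y; rewrite eqxx h orbT.
Qed.

Lemma lex_cat s t x y :
  lex_lt s t -> size t <= size s -> lex_lt (s ++ x) (t ++ y).
Proof.
move=> /lexP[[z -> zN0]|//]; rewrite size_cat.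
by case: z zN0 => //= c z _; lia.
Qed.

(** Suffixes replace rotations. If w = xy and y < w, then w < yx forces w = yz with z < x of equal
    length, so zy < xy = w, against the rotation zy of w. *)
Lemma lyndonP w : reflect
  (w != [::] /\ forall x y, w = x ++ y -> x != [::] -> y != [::] -> lex_lt w y)
  (lyndon w).
Proof.
apply: (iffP andP) => [[wN0 /allP wrot]|[wN0 wsuf]]; split=> //.
  have rotP x y : w = x ++ y -> x != [::] -> y != [::] -> lex_lt w (y ++ x).
    move=> wxy xN0 yN0; have := wrot (size x); rewrite wxy rot_size_cat; apply.
    rewrite mem_iota size_cat; case: x y xN0 yN0 {wxy} => [|a x] [|b y] //= _ _; lia.
  move=> x y wxy xN0 yN0; apply/negPn/negP => wNy.
  have: lex_lt y w.
    have := @lex_total w y; rewrite (negbTE wNy); apply; rewrite wxy.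
    apply: contra_neq xN0 => /(congr1 size); rewrite size_cat.
    by case: x {wxy} => //= a x; lia.
  case/lexP=> [[z wyz zN0]|yw]; last first.
    have := yw x [::]; rewrite cats0 => yxw.
    by have := lex_trans yxw (rotP _ _ wxy xN0 yN0); rewrite lex_irr.
  have sz : size z = size x.
    by move: (congr1 size wxy); rewrite wyz !size_cat; lia.
  have zx : lex_lt z x by have := rotP _ _ wxy xN0 yN0; rewrite {1}wyz lex_cat2l.
  have := rotP _ _ wyz yN0 zN0; rewrite wxy => wzy.
  have xzy : lex_lt (z ++ y) (x ++ y) by apply: lex_cat; rewrite ?sz.
  by have := lex_trans wzy xzy; rewrite lex_irr.
apply/allP => i; rewrite mem_iota => /andP[i0 iw].
have iw' : i < size w by lia.
rewrite /rot -[X in lex_lt X _]cats0; apply: lex_cat; last by rewrite size_drop; lia.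
apply: (wsuf (take i w)); rewrite ?cat_take_drop //.
  by rewrite nonnil_size size_takel; lia.
by rewrite nonnil_size size_drop; lia.
Qed.

Lemma lyndon_N0 w : lyndon w -> w != [::].
Proof. by case/andP. Qed.

Lemma lyndon_suffix w x y :
  lyndon w -> w = x ++ y -> x != [::] -> y != [::] -> lex_lt w y.
Proof. by case/lyndonP=> _; apply. Qed.

Lemma lyndon1 (c : 'I_k) : lyndon [:: c].
Proof. by []. Qed.

(** The crux is uv < v: if v = uz, cancelling u leaves v < z; otherwise u and v differ at a letter.
    A proper suffix of uv is either a suffix of v or a proper suffix of u followed by v. *)
Lemma lyndon_cat u v : lyndon u -> lyndon v -> lex_lt u v -> lyndon (u ++ v).
Proof.
move=> Lu Lv uv.
have uN0 := lyndon_N0 Lu; have vN0 := lyndon_N0 Lv.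
have uvv : lex_lt (u ++ v) v.
  case/lexP: (uv) => [[z vuz zN0]|h]; last by have := h v [::]; rewrite cats0.
  rewrite {2}vuz lex_cat2l; exact: lyndon_suffix vuz uN0 zN0.
apply/lyndonP; split; first by case: (u) uN0.
move=> x y Exy xN0 yN0.
have [le_ux|lt_xu] := leqP (size u) (size x).
  have vE : v = drop (size u) x ++ y.
    have := congr1 (drop (size u)) Exy.
    rewrite drop_size_cat // drop_cat; case: ltngtP le_ux => // -> _.
    by rewrite subnn drop0 drop_size.
  case Ed: (drop (size u) x) vE => [|a d] vE; first by rewrite -[y]vE.
  by apply: lex_trans uvv _; rewrite -Ed in vE; apply: lyndon_suffix vE _ _; rewrite ?Ed.
have uE : u = x ++ drop (size x) u.
  have := congr1 (take (size u)) Exy.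
  rewrite take_size_cat // take_cat ltnNge (ltnW lt_xu) /= => uE.
  by rewrite {2}uE drop_size_cat.
have yE : y = drop (size x) u ++ v.
  have := congr1 (drop (size x)) Exy.
  by rewrite drop_cat lt_xu drop_size_cat // => ->.
have dN0 : drop (size x) u != [::] by rewrite nonnil_size size_drop; lia.
rewrite yE; apply: lex_cat; first exact: lyndon_suffix uE xN0 dN0.
by rewrite size_drop; lia.
Qed.

(* For the factorisation p = p_1 ... p_m into nonincreasing Lyndon words,
   take q = p_1 and s = p_m. *)
Lemma lyndon_prefix_suffix p : p != [::] -> exists q r t s,
  [/\ p = q ++ r, lyndon q, p = t ++ s, s != [::] & ~~ lex_lt q s].
Proof.
(* The Lyndon prefix q absorbs the first factor q2 of what follows while q < q2; once this fails, q
   is the first factor. *)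
suff main n : forall q r, size r <= n -> lyndon q -> exists q' r' t s,
  [/\ q ++ r = q' ++ r', lyndon q', q ++ r = t ++ s, s != [::] & ~~ lex_lt q' s].
  by case: p => // c p _; apply: (main (size p) [:: c]).
elim: n => [|n IHn] q r szr Lq.
  case: r szr => // _; exists q, [::], [::], q.
  by rewrite cats0 lex_irr lyndon_N0.
case: r szr => [|c r] szr.
  by exists q, [::], [::], q; rewrite cats0 lex_irr lyndon_N0.
have [|q2 [r2 [t2 [s [E2 Lq2 Es sN0 q2s]]]]] := IHn [:: c] r _ (lyndon1 c).
  exact: szr.
have [qq2|Nqq2] := boolP (lex_lt q q2).
  have [|q' [r' [t [s' [E' Lq' Es' s'N0 qs']]]]] :=
    IHn (q ++ q2) r2 _ (lyndon_cat Lq Lq2 qq2).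
    have := congr1 size E2; rewrite !size_cat /=.
    by have := lyndon_N0 Lq2; rewrite nonnil_size; move: szr => /=; lia.
  exists q', r', t, s'; rewrite -cat1s E2 catA E'.
  by split=> //; rewrite -E'.
exists q, (c :: r), (q ++ t2), s; split=> //; first by rewrite -cat1s Es catA.
apply: contra Nqq2 => qs; have [->//|nq2s] := eqVneq q2 s.
by have := lex_total nq2s; rewrite (negbTE q2s) /=; apply: lex_trans.
Qed.

Lemma foldr_maxn_ge (i : nat) (s : seq nat) : i \in s -> i <= foldr maxn 0 s.
Proof. by elim: s => //= a s IHs; rewrite in_cons => /predU1P[->|/IHs]; lia. Qed.

Lemma foldr_maxn_mem (s : seq nat) : 0 < foldr maxn 0 s -> foldr maxn 0 s \in s.
Proof.
elim: s => //= a s IHs; rewrite in_cons.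
have [_|lt_a] := leqP (foldr maxn 0 s) a; first by rewrite eqxx.
by rewrite IHs ?orbT //; apply: leq_ltn_trans lt_a.
Qed.

Lemma sf_idx_ge w i : sf_ok w i -> i <= sf_idx w.
Proof.
move=> ok; apply: foldr_maxn_ge; rewrite mem_filter ok mem_iota /=.
by case/and5P: ok.
Qed.

Lemma sf_idx_ok w : 0 < sf_idx w -> sf_ok w (sf_idx w).
Proof. by move=> /foldr_maxn_mem; rewrite mem_filter => /andP[]. Qed.

Lemma lex_not_trans p q s : lex_lt p s -> ~~ lex_lt q s -> lex_lt p q.
Proof.
move=> ps; have [->//|nqs] := eqVneq q s.
by have := lex_total nqs; case: (lex_lt q s) => //= sq _; apply: lex_trans sq.
Qed.

(** The left factor is the longest proper Lyndon prefix. If r is Lyndon, the cut after q is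
    admissible. Otherwise the first and last factors q1, s of r satisfy q < w < s <= q1, so q q1 is
    a longer proper Lyndon prefix. *)
Lemma lyndon_prefix_le w q r :
  lyndon w -> w = q ++ r -> r != [::] -> lyndon q -> size q <= sf_idx w.
Proof.
move=> Lw; have [n] := ubnP (size r); elim: n q r => // n IHn q r szr Ew rN0 Lq.
have qN0 := lyndon_N0 Lq.
have qw : lex_lt q w by rewrite Ew lex_prefix.
have wr := lyndon_suffix Lw Ew qN0 rN0.
have [Lr|NLr] := boolP (lyndon r).
  apply: sf_idx_ge; rewrite /sf_ok Ew take_size_cat // drop_size_cat // Lq Lr.
  rewrite (lex_trans qw wr) size_cat.
  by move: qN0 rN0; rewrite !nonnil_size; lia.
have [q1 [r1 [t [s [Er Lq1 Es sN0 q1s]]]]] := lyndon_prefix_suffix rN0.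
have r1N0 : r1 != [::].
  by apply: contraNneq NLr => r10; rewrite Er r10 cats0.
have ws : lex_lt w s.
  by apply: (lyndon_suffix Lw (x := q ++ t)); rewrite -?catA -?Es //; case: (q) qN0.
have qq1 : lex_lt q q1 by apply: lex_not_trans q1s; apply: lex_trans ws.
have := IHn (q ++ q1) r1 _ _ r1N0 (lyndon_cat Lq Lq1 qq1).
rewrite -catA -Er size_cat => /(_ _ Ew) h.
apply: leq_trans (leq_addr (size q1) _) (h _) => {h}; move: szr; rewrite Er size_cat.
by have := lyndon_N0 Lq1; rewrite nonnil_size; lia.
Qed.

(** The one-letter prefix is Lyndon, so the maximum defining [sf_idx] is not its default 0. *)
Lemma lyndon_sf w : lyndon w -> 1 < size w -> sf_ok w (sf_idx w).
Proof.
case: w => [|c [|d w]] // Lw _; apply: sf_idx_ok.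
exact: (@lyndon_prefix_le _ [:: c] (d :: w)).
Qed.

Lemma lyndon_sf_cat w : lyndon w -> 1 < size w -> exists u v,
  [/\ w = u ++ v, lyndon u, lyndon v, lex_lt u v & sf_idx w = size u].
Proof.
move=> Lw sw; have /and5P[i0 iw Lu Lv uv] := lyndon_sf Lw sw.
exists (take (sf_idx w) w), (drop (sf_idx w) w).
by rewrite cat_take_drop size_takel // ltnW.
Qed.

Lemma lyndon_ind (Pr : seq 'I_k -> Prop) :
  (forall c, Pr [:: c]) ->
  (forall u v, lyndon u -> lyndon v -> lyndon (u ++ v) -> lex_lt u v ->
     sf_idx (u ++ v) = size u -> Pr u -> Pr v -> Pr (u ++ v)) ->
  forall w, lyndon w -> Pr w.
Proof.
move=> Pr1 PrC w; have [n] := ubnP (size w); elim: n w => // n IHn w szw Lw.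
case: (ltnP 1 (size w)) => [sw|]; last first.
  by case: (w) Lw => [|c [|]].
have [u [v [E Lu Lv uv sf]]] := lyndon_sf_cat Lw sw.
have u0 := lyndon_N0 Lu; have v0 := lyndon_N0 Lv.
move: szw u0 v0; rewrite E size_cat !nonnil_size => szw u0 v0; rewrite E in Lw sf.
by apply: PrC => //; apply: IHn => //; lia.
Qed.

(** Were u smaller than the left factor u2 of v, the prefix u u2 would be Lyndon and longer than
    u. *)
Lemma sf_left_le u v : lyndon (u ++ v) -> lyndon u -> lyndon v ->
  sf_idx (u ++ v) = size u -> 1 < size v -> ~~ lex_lt u (take (sf_idx v) v).
Proof.
move=> Luv Lu Lv sf sv; apply/negP.
have [u2 [v2 [E Lu2 Lv2 _ ->]]] := lyndon_sf_cat Lv sv.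
rewrite {1}E take_size_cat // => uu2.
have := @lyndon_prefix_le (u ++ v) (u ++ u2) v2 Luv.
rewrite {1}E catA => /(_ erefl (lyndon_N0 Lv2) (lyndon_cat Lu Lu2 uu2)).
rewrite sf size_cat; have := lyndon_N0 Lu2; rewrite nonnil_size; lia.
Qed.

(** A longer Lyndon prefix lp would give, for the first and last factors q, s of p, l < lp < s <= q.
    As q is a prefix of the left factor of w, that factor would exceed l. *)
Lemma sf_idx_cat l w : lyndon l -> lyndon w -> lex_lt l w ->
  (1 < size w -> ~~ lex_lt l (take (sf_idx w) w)) -> sf_idx (l ++ w) = size l.
Proof.
move=> Ll Lw lw hw; have LW := lyndon_cat Ll Lw lw.
have lN0 := lyndon_N0 Ll; have wN0 := lyndon_N0 Lw.
have ge : size l <= sf_idx (l ++ w) by apply: lyndon_prefix_le wN0 Ll.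
apply/eqP; rewrite eqn_leq ge andbT leqNgt; apply/negP => lt.
have /and5P[_ iw Li _ _] : sf_ok (l ++ w) (sf_idx (l ++ w)).
  by apply: sf_idx_ok; apply: leq_ltn_trans lt.
move: (sf_idx _) ge lt Li iw => i ge lt.
rewrite take_cat ltnNge (ltnW lt) /= size_cat => Lp iw.
have [jw j0] : i - size l < size w /\ 0 < i - size l by lia.
move: (i - size l) jw j0 Lp => j jw j0 Lp.
have pN0 : take j w != [::] by rewrite nonnil_size size_takel; lia.
have [q [r [t [s [Eq Lq Es sN0 qs]]]]] := lyndon_prefix_suffix pN0.
have lps : lex_lt (l ++ take j w) s.
  by apply: (lyndon_suffix Lp (x := l ++ t)); rewrite ?Es ?catA //; case: (l) lN0.
have lq : lex_lt l q.
  by apply: lex_not_trans qs; apply: lex_trans lps; apply: lex_prefix.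
have Ew : w = q ++ (r ++ drop j w) by rewrite catA -Eq cat_take_drop.
have rN0 : r ++ drop j w != [::].
  by rewrite nonnil_size size_cat size_drop addn_gt0 subn_gt0 jw orbT.
have qsf := lyndon_prefix_le Lw Ew rN0 Lq.
have sw : 1 < size w.
  apply: leq_ltn_trans (jw); rewrite -(size_takel (ltnW jw)) Eq size_cat.
  by rewrite ltn_addr // -nonnil_size lyndon_N0.
have /negP := hw sw; apply.
have tE : take (sf_idx w) w = q ++ take (sf_idx w - size q) (r ++ drop j w).
  by rewrite {2}Ew take_cat ltnNge qsf.
rewrite tE; case: (take _ (r ++ _)) => [|a z]; first by rewrite cats0.
exact/(lex_trans lq)/lex_prefix.
Qed.

End LyndonWords.

(** * Leaf words of trees *)

Section Trees.
Local Open Scope nat_scope.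

Fixpoint leaves (T : Type) (t : tree T) : seq T :=
  match t with
  | Leaf x => [:: x]
  | Node a b => leaves a ++ leaves b
  end.

Lemma tmap_comp (A B C : Type) (g : B -> C) (f : A -> B) t :
  tmap g (tmap f t) = tmap (g \o f) t.
Proof. by elim: t => //= a -> b ->. Qed.

Lemma eq_in_tmap (A : eqType) (B : Type) (f g : A -> B) t :
  {in leaves t, f =1 g} -> tmap f t = tmap g t.
Proof.
elim: t => [x|a IHa b IHb] fg /=; first by rewrite fg ?mem_head.
rewrite IHa ?IHb // => x xl; apply: fg; rewrite mem_cat xl ?orbT //.
Qed.

Lemma leaves_tmap (A B : Type) (f : A -> B) t :
  leaves (tmap f t) = map f (leaves t).
Proof. by elim: t => //= a -> b ->; rewrite map_cat. Qed.

Lemma size_leaves (T : Type) (t : tree T) : size (leaves t) = nleaves t.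
Proof. by elim: t => //= a IHa b IHb; rewrite size_cat IHa IHb. Qed.

(* A tree is determined by its shape and the word of its leaves. *)
Lemma tree_shape_nth (A B : Type) (f : A -> B) (g : nat -> B) (x0 : A) t s m :
  leaves s = iota m (nleaves s) -> tmap f t = tmap g s ->
  t = tmap (fun p => nth x0 (leaves t) (p - m)) s.
Proof.
elim: t s m => [x|a IHa b IHb] [p|c d] m //=; first by case=> ->; rewrite subnn.
have size_eq t' s' : tmap f t' = tmap g s' -> nleaves t' = nleaves s'.
  by move/(congr1 (fun r => size (leaves r))); rewrite !leaves_tmap !size_map !size_leaves.
rewrite iotaD => Es [Ea Eb].
have sc : size (leaves c) = size (iota m (nleaves c)) by rewrite size_leaves size_iota.
have Lc : leaves c = iota m (nleaves c).
  by have := congr1 (take (size (leaves c))) Es; rewrite take_size_cat // sc take_size_cat.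
have Ld : leaves d = iota (m + nleaves c) (nleaves d).
  by have := congr1 (drop (size (leaves c))) Es; rewrite drop_size_cat // sc drop_size_cat.
have sa : size (leaves a) = nleaves c by rewrite size_leaves (size_eq _ _ Ea).
congr Node.
  rewrite {1}(IHa _ _ Lc Ea); apply: eq_in_tmap => p; rewrite Lc mem_iota => pm.
  by rewrite nth_cat sa ifT //; lia.
rewrite {1}(IHb _ _ Ld Eb); apply: eq_in_tmap => p; rewrite Ld mem_iota => pm.
by rewrite nth_cat sa ifF; [congr nth; lia|lia].
Qed.

End Trees.

(** * The standard bracketing of a Lyndon word as a tree *)

Section LyndonTrees.
Local Open Scope nat_scope.
Variables (k : nat) (c0 : 'I_k).
Implicit Types (u v w l : seq 'I_k).

(* [phi_pos] only makes sense on Lyndon words, where [sf_idx] is a proper cut. *)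
Lemma phi_posE n m off off' w : lyndon w -> size w <= n -> size w <= m ->
  phi_pos n (off + off') w = tmap (addn off) (phi_pos m off' w).
Proof.
elim: n m off' w => [|n IHn] [|m] off' w Lw; try by case: w Lw.
move=> wn wm /=; case: leqP => [//|sw] /=.
have /and5P[i0 iw Lu Lv _] := lyndon_sf Lw sw.
set i := sf_idx w in i0 iw Lu Lv *.
have tn : size (take i w) < size w by rewrite size_takel // ltnW.
have dn : size (drop i w) < size w by rewrite size_drop; lia.
by congr Node; rewrite -?addnA; apply: IHn => //; lia.
Qed.

Lemma phi_cat u v : lyndon u -> lyndon v -> lyndon (u ++ v) ->
  sf_idx (u ++ v) = size u ->
  phi (u ++ v) = Node (phi u) (tmap (addn (size u)) (phi v)).
Proof.
move=> Lu Lv Luv sf.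
have u0 := lyndon_N0 Lu; have v0 := lyndon_N0 Lv.
rewrite !nonnil_size in u0 v0.
have sw : 1 < size (u ++ v) by rewrite size_cat; lia.
rewrite {1}/phi; case E: (size (u ++ v)) sw => [|n] //= sw.
rewrite E leqNgt sw /= sf take_size_cat // drop_size_cat //.
move: E; rewrite size_cat => E.
rewrite add0n -[0]/(0 + 0) -[size u in LHS]addn0; congr Node.
  rewrite (phi_posE (m := size u)) //; last lia.
  by rewrite -/(phi u); elim: (phi u) => //= a -> b ->.
by apply: phi_posE => //; lia.
Qed.

Lemma leaves_phi w : lyndon w -> leaves (phi w) = iota 0 (size w).
Proof.
move: w; apply: lyndon_ind => // u v Lu Lv Luv _ sf IHu IHv.
rewrite phi_cat //= leaves_tmap IHu IHv size_cat iotaD add0n.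
by rewrite -iotaDl addn0.
Qed.

Lemma nleaves_phi w : lyndon w -> nleaves (phi w) = size w.
Proof. by move=> Lw; rewrite -size_leaves leaves_phi // size_iota. Qed.

Definition ltree w : tree 'I_k := tmap (nth c0 w) (phi w).

Lemma leaves_ltree w : lyndon w -> leaves (ltree w) = w.
Proof.
move=> Lw; rewrite leaves_tmap leaves_phi //.
exact: mkseq_nth.
Qed.

Lemma nleaves_ltree w : lyndon w -> nleaves (ltree w) = size w.
Proof. by move=> Lw; rewrite -size_leaves leaves_ltree. Qed.

Lemma ltree_inj : {in @lyndon k &, injective ltree}.
Proof. by move=> u v Lu Lv /(congr1 (@leaves _)); rewrite !leaves_ltree. Qed.

Lemma ltree_cat u v : lyndon u -> lyndon v -> lyndon (u ++ v) ->
  sf_idx (u ++ v) = size u -> ltree (u ++ v) = Node (ltree u) (ltree v).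
Proof.
move=> Lu Lv Luv sf; rewrite /ltree phi_cat //= tmap_comp; congr Node.
  apply: eq_in_tmap => p; rewrite leaves_phi // mem_iota => /andP[_ pu].
  by rewrite nth_cat ifT.
apply: eq_in_tmap => p _ /=.
by rewrite nth_cat ifF; [congr nth; lia|lia].
Qed.

Lemma lyndon_enum N : exists W : seq (seq 'I_k),
  sorted (@lex_lt k) W /\ forall w, (w \in W) = lyndon w && (size w <= N).
Proof.
pose s := undup [seq w <- flatten [seq [seq tval t | t <- enum {:n.-tuple 'I_k}]
   | n <- iota 0 N.+1] | lyndon w].
pose le (u v : seq 'I_k) := (u == v) || lex_lt u v.
have le_total : total le.
  move=> u v; rewrite /le [v == u]eq_sym; case: eqVneq => //= /lex_total.
  by [].
exists (sort le s); split.
  have: pairwise le (sort le s).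
    rewrite -sorted_pairwise ?sort_sorted //.
    move=> v u w; rewrite /le => /predU1P[->//|uv] /predU1P[<-|vw].
      by rewrite uv orbT.
    by rewrite (lex_trans uv vw) orbT.
  have: uniq (sort le s) by rewrite sort_uniq undup_uniq.
  elim: (sort le s) => //= u r IHr /andP[ur /IHr {}IHr] /andP[/allP ler /IHr].
  case: r ur ler {IHr} => //= v r; rewrite in_cons negb_or => /andP[uv _] ler ->.
  by have := ler v (mem_head _ _); rewrite /le (negbTE uv) andbT.
move=> w; rewrite mem_sort mem_undup mem_filter; congr andb.
apply/flatten_mapP/idP => [[n]|sw].
  by rewrite mem_iota => nN /mapP[t _ ->]; rewrite size_tuple; lia.
exists (size w); first by rewrite mem_iota; lia.
by apply/mapP; exists (in_tuple w); rewrite ?mem_enum.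
Qed.

(** * Lyndon words in increasing order as an elimination sequence *)

Section Sequence.
Variables (N : nat) (W : seq (seq 'I_k)).
Hypothesis sortedW : sorted (@lex_lt k) W.
Hypothesis memW : forall w, (w \in W) = lyndon w && (size w <= N).

(** Reversed because [alph] and [lazard] expect the last eliminated tree at the head. *)
Definition elim_list (V : seq (seq 'I_k)) := rev (map ltree V).

Lemma elim_list_rcons V l : elim_list (rcons V l) = ltree l :: elim_list V.
Proof. by rewrite /elim_list map_rcons rev_rcons. Qed.

(* Eliminating l creates the words l w with w > l in the alphabet; by [sf_idx_cat]
   and [sf_left_le] these are exactly the Lyndon words with left factor l. *)
Lemma lyndon_lazard W1 W2 : W = W1 ++ W2 ->
  lazard (elim_list W1) /\ forall t, nleaves t <= N ->
  (alph (elim_list W1) t <-> exists w,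
    [/\ w \in W2, t = ltree w & 1 < size w -> take (sf_idx w) w \in W1]).
Proof.
elim/last_ind: W1 W2 => [|W1 l IH] W2 EW.
  split=> // t tN /=; split.
    case: t tN => // c tN _; exists [:: c]; split=> //.
    by rewrite -[W2]EW memW lyndon1.
  case=> w [wW2 -> hw]; have: w \in W by rewrite EW.
  rewrite memW => /andP[Lw _]; case: w Lw hw {wW2} => [|c [|d w]] //= Lw.
  by move=> /(_ isT).
rewrite cat_rcons in EW; have [lazH alphH] := IH _ EW.
have: pairwise (@lex_lt k) W by rewrite -sorted_pairwise //; apply: lex_trans.
rewrite EW pairwise_cat /= allrel_consr.
move=> /and3P[/andP[/allP W1l _] _ /andP[/allP lW2 _]].
have lW : l \in W by rewrite EW mem_cat mem_head orbT.
have := lW; rewrite memW => /andP[Ll sl].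
have W1W w : w \in W1 -> w \in W by rewrite EW mem_cat => ->.
have W2W w : w \in W2 -> w \in W.
  by rewrite EW mem_cat in_cons orbCA => ->; rewrite !orbT.
have inW2 w : w \in W -> lex_lt l w -> w \in W2.
  rewrite EW mem_cat in_cons => /or3P[/W1l wl lw|/eqP->|//]; last by rewrite lex_irr.
  by have := lex_trans wl lw; rewrite lex_irr.
have inW1 w : w \in W -> ~~ lex_lt l w -> w \in rcons W1 l.
  by rewrite EW mem_cat in_cons mem_rcons in_cons => /or3P[->|->|/lW2->//]; rewrite ?orbT.
have lN1 : l \notin W1 by apply/negP => /W1l; rewrite lex_irr.
have LW2 w : w \in W2 -> lyndon w by move=> /W2W; rewrite memW => /andP[].
have nltl w : w \in W2 -> ltree w != ltree l.
  move=> wW2; apply/eqP => /ltree_inj E; have := lW2 w wW2.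
  by rewrite E ?lex_irr // -topredE /= ?LW2.
have takeW w : lyndon w -> size w <= N -> 1 < size w -> take (sf_idx w) w \in W.
  move=> Lw sw w1; rewrite memW; have /and5P[_ iw -> _ _] := lyndon_sf Lw w1.
  by rewrite size_takel; lia.
rewrite elim_list_rcons; split=> [/=|].
  rewrite lazH andbT; apply/andP; split.
    (* The left factor of l is a proper prefix, hence smaller than l and already eliminated; so l
       belongs to the current alphabet. *)
    apply/alphH; first by rewrite nleaves_ltree.
    exists l; split; rewrite ?mem_head // => l1.
    have := takeW l Ll sl l1; have [u [v [E Lu Lv _ ->]]] := lyndon_sf_cat Ll l1.
    rewrite {1 2}E take_size_cat // => /inW1.
    have ul : lex_lt u l by rewrite E lex_prefix ?lyndon_N0.
    have Nlu : ~~ lex_lt l u by apply/negP => /lex_trans/(_ ul); rewrite lex_irr.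
    move=> /(_ Nlu); rewrite mem_rcons in_cons => /predU1P[ul'|//].
    by rewrite ul' lex_irr in ul.
  rewrite mem_rev; apply/mapP => -[w wW1 /ltree_inj E].
  have Lw : lyndon w by have := W1W w wW1; rewrite memW => /andP[].
  by move: lN1; rewrite E // wW1.
move=> t tN; split.
  (* A new letter is [l,w] where the left factor of w, if w is not a letter, is at most l; then l is
     the left factor of lw. *)
  move=> At; elim/elim_alph_ind: t / At tN => [t At tl|a b /eqP-> _ IHb] tN.
    have [w [wl E hw]] := (alphH t tN).1 At; exists w; split=> //.
      by move: wl; rewrite in_cons => /predU1P[wl|//]; rewrite E wl /= eqxx in tl.
    by move=> w1; rewrite mem_rcons in_cons hw ?orbT.
  have [|w [wW2 Eb hw]] := IHb; first by move: tN => /=; lia.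
  rewrite Eb in tN *.
  have lw := lW2 w wW2; have Lw := LW2 w wW2.
  have sf : sf_idx (l ++ w) = size l.
    apply: sf_idx_cat => // w1; have := hw w1.
    rewrite mem_rcons in_cons => /predU1P[->|/W1l ul]; first by rewrite lex_irr.
    by apply/negP => /lex_trans/(_ ul); rewrite lex_irr.
  have Llw := lyndon_cat Ll Lw lw.
  exists (l ++ w); split; first last.
  - by rewrite sf take_size_cat // mem_rcons mem_head.
  - by rewrite ltree_cat.
  apply: inW2; last by rewrite lex_prefix ?lyndon_N0.
  by rewrite memW Llw /= -nleaves_ltree // ltree_cat.
case=> w [wW2 -> {t tN} hw].
(* Induction on length: if w = lv has left factor l, then v exceeds l and its own left factor is at
   most l, so v meets the same condition. *)
have [n] := ubnP (size w); elim: n w wW2 hw => // n IHn w wW2 hw wn.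
have Lw := LW2 w wW2.
have wN : size w <= N by have := W2W w wW2; rewrite memW => /andP[].
have old : (1 < size w -> take (sf_idx w) w \in W1) ->
    elim_alph (pred1 (ltree l)) (alph (elim_list W1)) (ltree w).
  move=> hw1; have Aw : alph (elim_list W1) (ltree w).
    apply/alphH; first by rewrite nleaves_ltree.
    by exists w; rewrite in_cons wW2 orbT.
  by move: (nltl w wW2) Aw; case: (ltree w) => [c|a b] /= -> ->.
have [w1|w1] := ltnP 1 (size w); last by apply: old; rewrite ltnNge w1.
have := hw w1; rewrite mem_rcons in_cons => /predU1P[ul|uW1]; last by apply: old.
have [u [v [E Lu Lv uv sf]]] := lyndon_sf_cat Lw w1.
have {ul} ul : u = l by rewrite -ul sf E take_size_cat.
rewrite {u}ul in E Lu uv sf.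
rewrite E in Lw sf wn wN *; rewrite ltree_cat //.
apply: elim_alph_node; first by rewrite /= eqxx.
have sv : size v <= N by move: wN; rewrite size_cat; lia.
apply: IHn.
- by apply: inW2; rewrite // memW Lv.
- move=> v1; apply: inW1; first exact: takeW.
  exact: sf_left_le Lw Lu Lv sf v1.
have := lyndon_N0 Lu; rewrite nonnil_size.
by move: wn; rewrite size_cat; lia.
Qed.

End Sequence.

End LyndonTrees.

(** * Tensor bases *)

Section Blocks.
Local Open Scope nat_scope.
Variables (k : nat) (X : choiceType) (col : X -> 'I_k).
Implicit Types (u : seq 'I_k) (s : seq X) (c : 'I_k).

Definition colour_part c s := [seq y <- s | col y == c].

(** A stable sort by colour, taking the leaf word of a tree back to a tensor basis vector. *)
Definition block_sort s := flatten [seq colour_part i s | i <- enum 'I_k].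

Lemma size_colour_part c s : size (colour_part c s) = count_mem c (map col s).
Proof. by rewrite size_filter count_map. Qed.

Lemma map_block_sort s : map col (block_sort s) = block_word (map col s).
Proof.
rewrite /block_sort map_flatten -map_comp; congr flatten; apply: eq_map => i /=.
rewrite -size_colour_part -[size _](size_map col); apply/all_pred1P.
by apply/allP => c /mapP[y]; rewrite mem_filter => /andP[/eqP yi _] ->; apply/eqP.
Qed.

Lemma colour_part_block_sort c s : colour_part c (block_sort s) = colour_part c s.
Proof.
rewrite /colour_part /block_sort filter_flatten -map_comp.
have part i : colour_part c (colour_part i s) = if i == c then colour_part c s else [::].
  rewrite /colour_part -filter_predI; have [->|ic] := eqVneq i c.
    by apply: eq_filter => y /=; rewrite andbb.
  rewrite -(filter_pred0 s); apply: eq_filter => y /=.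
  by apply/negP => /andP[/eqP-> /eqP E]; rewrite E eqxx in ic.
rewrite (eq_map part).
have: uniq (enum 'I_k) by apply: enum_uniq.
have: c \in enum 'I_k by rewrite mem_enum.
elim: (enum 'I_k) => //= i e IHe; rewrite in_cons.
case: eqVneq => [<-|ic] /=; last by move=> ce /andP[_ ue]; rewrite IHe.
move=> _ /andP[ce _]; set r := map _ _.
suff ->: flatten r = [::] by rewrite cats0.
rewrite {}/r; elim: e ce {IHe} => //= j e IHe; rewrite in_cons negb_or eq_sym.
by case/andP=> /negbTE -> /IHe.
Qed.

Lemma block_sort_id u s : map col s = block_word u -> block_sort s = s.
Proof.
rewrite /block_sort /block_word.
have: uniq (enum 'I_k) by apply: enum_uniq.
elim: (enum 'I_k) s => [|i e IHe] s /=; first by case: s.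
case/andP=> ie ue Es; pose n := count_mem i u.
have sn : n <= size s by rewrite -(size_map col) Es size_cat size_nseq leq_addr.
have E1 : map col (take n s) = nseq n i by rewrite map_take Es take_size_cat ?size_nseq.
have E2 : map col (drop n s) = flatten [seq nseq (count_mem j u) j | j <- e].
  by rewrite map_drop Es drop_size_cat ?size_nseq.
have c1 y : y \in take n s -> col y = i.
  by move=> /(map_f col); rewrite E1 mem_nseq => /andP[_ /eqP].
have c2 y : y \in drop n s -> col y \in e.
  move=> /(map_f col); rewrite E2 => /flattenP[r /mapP[j je ->]].
  by rewrite mem_nseq => /andP[_ /eqP->].
rewrite -[RHS](cat_take_drop n) -[X in _ = _ ++ X]IHe //.
rewrite -{1}(cat_take_drop n s) /colour_part filter_cat.
have /all_filterP -> : all (fun y => col y == i) (take n s).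
  by apply/allP => y /c1 ->.
rewrite (eq_in_filter (a2 := pred0) (s := drop n s)); last first.
  by move=> y /c2 ye; apply/eqP => yi; rewrite -yi ye in ie.
rewrite filter_pred0 cats0; congr (_ ++ flatten _); apply/eq_in_map => j je.
rewrite -{1}(cat_take_drop n s) filter_cat.
rewrite (eq_in_filter (a2 := pred0) (s := take n s)) ?filter_pred0 //.
by move=> y /c1 ->; apply/eqP => ij; rewrite ij je in ie.
Qed.

Lemma nth_filter_count (T : Type) (P : pred T) (x0 : T) (r : seq T) p :
  p < size r -> P (nth x0 r p) ->
  nth x0 (filter P r) (count P (take p r)) = nth x0 r p.
Proof.
move=> pr Py; rewrite -{1}(cat_take_drop p r) filter_cat nth_cat size_filter ltnn.
by rewrite subnn (drop_nth x0) //= Py.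
Qed.

Lemma count_take_lt (T : Type) (P : pred T) (x0 : T) (r : seq T) p :
  p < size r -> P (nth x0 r p) -> count P (take p r) < count P r.
Proof.
move=> pr Py; rewrite -{2}(cat_take_drop p r) count_cat (drop_nth x0) //= Py.
by rewrite -addn1 leq_add2l.
Qed.

Lemma count_take_ex (T : Type) (P : pred T) (x0 : T) (r : seq T) j :
  j < count P r -> exists p, [/\ p < size r, P (nth x0 r p) & count P (take p r) = j].
Proof.
elim: r j => [//|a r IHr] j /=; case Pa: (P a) => /=.
  case: j => [_|j]; first by exists 0.
  rewrite add1n ltnS => /IHr[p [pr Pp Ep]]; exists p.+1; split=> //=.
  by rewrite Pa Ep.
rewrite add0n => /IHr[p [pr Pp Ep]]; exists p.+1; split=> //=.
by rewrite Pa Ep.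
Qed.

Variable x0 : X.
Let c0 := col x0.

(** The substitution inside [beta_mon], with default values independent of [u] and [s]. *)
Definition block_nth u s p : X :=
  nth x0 (colour_part (nth c0 u p) s) (count_mem (nth c0 u p) (take p u)).

Lemma count_block_word u c : count_mem c (block_word u) = count_mem c u.
Proof.
rewrite /block_word count_flatten -map_comp.
have part i : count_mem c (nseq (count_mem i u) i) = if i == c then count_mem c u else 0.
  by rewrite count_nseq /=; case: eqVneq => [->|]; rewrite ?mul1n.
rewrite (eq_map part).
have: uniq (enum 'I_k) by apply: enum_uniq.
have: c \in enum 'I_k by rewrite mem_enum.
elim: (enum 'I_k) => //= i e IHe; rewrite in_cons.
case: eqVneq => [<-|ic] /=; last by move=> ce /andP[_ ue]; rewrite add0n IHe.
move=> _ /andP[ce _]; rewrite -[RHS]addn0; congr addn.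
elim: e ce {IHe} => //= j e IHe; rewrite in_cons negb_or eq_sym.
by case/andP=> /negbTE -> /IHe.
Qed.

Section BlockNth.
Variables (u : seq 'I_k) (s : seq X).
Hypothesis su : map col s = block_word u.

Lemma block_nth_lt p : p < size u ->
  count_mem (nth c0 u p) (take p u) < size (colour_part (nth c0 u p) s).
Proof.
move=> pu; rewrite size_colour_part su count_block_word.
by apply: (count_take_lt (x0 := c0)) => //=.
Qed.

Lemma col_block_nth p : p < size u -> col (block_nth u s p) = nth c0 u p.
Proof.
move=> /block_nth_lt lt; have := mem_nth x0 lt.
by rewrite mem_filter => /andP[/eqP].
Qed.

Lemma map_col_block_nth : map col (mkseq (block_nth u s) (size u)) = u.
Proof.
rewrite -[RHS](mkseq_nth c0) -map_comp; apply/eq_in_map => p.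
by rewrite mem_iota => /col_block_nth.
Qed.

(** The j-th entry of colour c in [s] is placed at the j-th occurrence of c in [u], so collecting
    colours in order restores [s]. Hence the leaves determine the basis vector. *)
Lemma mkseq_block_nthK : block_sort (mkseq (block_nth u s) (size u)) = s.
Proof.
set s' := mkseq _ _.
rewrite -[RHS](block_sort_id su) /block_sort; congr flatten; apply: eq_map => c.
have sz : size (colour_part c s') = count_mem c u.
  by rewrite size_colour_part map_col_block_nth.
apply: (@eq_from_nth _ x0).
  by rewrite sz size_colour_part su count_block_word.
move=> j; rewrite sz => /(count_take_ex c0)[p [pu /= /eqP uc <-]].
have Ep : nth x0 s' p = block_nth u s p by rewrite nth_mkseq.
have -> : nth x0 (colour_part c s) (count_mem c (take p u)) = nth x0 s' p.
  by rewrite Ep /block_nth uc.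
have -> : count_mem c (take p u) = count (fun y => col y == c) (take p s').
  by rewrite -[u in LHS]map_col_block_nth -map_take count_map.
apply: (nth_filter_count (P := fun y => col y == c)); first by rewrite size_mkseq.
by rewrite Ep col_block_nth // uc.
Qed.

End BlockNth.

Lemma block_nth_sort s p : p < size s ->
  block_nth (map col s) (block_sort s) p = nth x0 s p.
Proof.
move=> ps; rewrite /block_nth colour_part_block_sort (nth_map x0) //.
rewrite -map_take count_map.
exact: (nth_filter_count (P := fun y => col y == _)).
Qed.

Definition block_tree u s : tree X := tmap (block_nth u s) (phi u).

Lemma beta_monE u s : lyndon u -> map col s = block_word u ->
  beta_mon col u s = << block_tree u s >>%R.
Proof.
move=> Lu su; case: u Lu su => [//|c u] Lu su.
case: s su => [|x s] su.
  (* An empty [s] would make the block word empty, but the first letter of [u] occurs in it. *)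
  by have := count_block_word (c :: u) c; rewrite -su /= eqxx.
rewrite /beta_mon /block_tree; congr Freeg; congr [:: (_, _)].
apply: eq_in_tmap => p; rewrite leaves_phi // mem_iota => /andP[_ pu].
rewrite /block_nth (set_nth_default c0 c) //.
by apply: set_nth_default; apply: block_nth_lt.
Qed.

Lemma col_block_tree u s : lyndon u -> map col s = block_word u ->
  tmap col (block_tree u s) = ltree c0 u.
Proof.
move=> Lu su; rewrite /block_tree tmap_comp; apply: eq_in_tmap => p.
by rewrite leaves_phi // mem_iota => /andP[_ pu] /=; rewrite col_block_nth.
Qed.

Lemma leaves_block_tree u s : lyndon u ->
  leaves (block_tree u s) = mkseq (block_nth u s) (size u).
Proof. by move=> Lu; rewrite leaves_tmap leaves_phi. Qed.

(** The colours force the shape phi(u), so [t] is recovered from its leaf word, and sorting that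
    word gives the preimage. *)
Lemma block_tree_surj u t : lyndon u -> tmap col t = ltree c0 u ->
  map col (block_sort (leaves t)) = block_word u /\
  block_tree u (block_sort (leaves t)) = t.
Proof.
move=> Lu Et; have Eu : map col (leaves t) = u by rewrite -leaves_tmap Et leaves_ltree.
split; first by rewrite map_block_sort Eu.
have Lphi : leaves (phi u) = iota 0 (nleaves (phi u)).
  by rewrite leaves_phi // nleaves_phi.
rewrite {2}(tree_shape_nth x0 Lphi Et); apply: eq_in_tmap => p.
rewrite leaves_phi // mem_iota subn0 => /andP[_ pu].
by rewrite -{1}Eu block_nth_sort // -(size_map col) Eu.
Qed.

End Blocks.

(** * Lifting the maps to letters of one colour *)

Section TensorBasis.
Variables (k : nat) (X : choiceType) (col : X -> 'I_k) (x0 : X).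
Let c0 := col x0.
Implicit Types u : lyndon_word k.

(** Keeps each value of beta_u as a single letter, so that the source becomes the free Lie ring on
    the letters of one colour. *)
Definition beta_lift u : nafree (tensor_basis col (val u)) -> nafree (tree X) :=
  alg_ext (fun y => << Leaf (block_tree col x0 (val u) (val y)) >>).

Definition colour u := coltree col (pred1 (ltree c0 (val u))).

Lemma flat_beta_lift u a : flat (beta_lift a) = beta_tilde (u := u) a.
Proof.
rewrite /flat /beta_lift alg_ext_comp.
apply: eq_alg_ext (supp_tallT a) => y _.
by rewrite alg_ext1 /= (beta_monE x0 (valP u) (eqP (valP y))).
Qed.

Lemma supp_beta_lift u (a : nafree (tensor_basis col (val u))) :
  supp (tall (colour u)) (beta_lift a).
Proof.
apply: supp_alg_ext (supp_tallT a) => y _; rewrite supp1 /= /colour /coltree.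
by rewrite col_block_tree ?(valP u) ?(eqP (valP y)) //= eqxx.
Qed.

Lemma beta_lift_ideal u (a : nafree (tensor_basis col (val u))) :
  lie_ideal (beta_lift a) -> lie_ideal a.
Proof.
(* The inverse on letters; 0 is a default for trees whose sorted leaves are not a basis vector. *)
pose g (t : tree X) : nafree (tensor_basis col (val u)) :=
  if insub (block_sort col (leaves t)) is Some y then << Leaf y >> else 0.
move=> /(alg_ext_ideal g); rewrite /beta_lift alg_ext_comp.
rewrite (eq_alg_ext (g := fun y => << Leaf y >>) _ (supp_tallT a)) ?alg_ext_id //.
move=> y _; rewrite alg_ext1 /= /g leaves_block_tree ?(valP u) //.
by rewrite (mkseq_block_nthK x0 (eqP (valP y))) valK.
Qed.

Lemma beta_lift_surj u (x : nafree (tree X)) :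
  supp (tall (colour u)) x ->
  exists a : nafree (tensor_basis col (val u)), beta_lift a = x.
Proof.
move: x; apply: supp_ind => [|x y [a <-] [b <-]|t].
- by exists 0; rewrite /beta_lift raddf0.
- by exists (a - b); rewrite /beta_lift raddfB.
elim: t => [t|s IHs t IHt] /=.
  move=> /eqP /(block_tree_surj (valP u)) [/eqP h E].
  exists << Leaf (exist _ (block_sort col (leaves t)) h : tensor_basis col (val u)) >>.
  by rewrite /beta_lift alg_ext1 /= E.
case/andP=> /IHs[a Ea] /IHt[b Eb]; exists (br a b).
by rewrite /beta_lift alg_ext_br -/(beta_lift a) -/(beta_lift b) Ea Eb br1.
Qed.

End TensorBasis.

(** * Injectivity and surjectivity of the sum of the maps *)

Lemma lazard_uniq (C : choiceType) (H : seq (tree C)) : lazard H -> uniq H.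
Proof. by elim: H => //= h H IHH /and3P[_ -> /IHH]. Qed.

Fixpoint first_leaf (T : Type) (t : tree T) : T :=
  match t with Leaf x => x | Node a _ => first_leaf a end.

Lemma filter_uniq_map (T U : eqType) (f : T -> U) (s : seq T) z :
  uniq (map f s) -> z \in s -> [seq y <- s | f y == f z] = [:: z].
Proof.
elim: s => //= y s IHs /andP[ys us]; rewrite in_cons => /predU1P[->|zs].
  rewrite eqxx (eq_in_filter (a2 := pred0)) ?filter_pred0 // => w ws.
  by apply/eqP => E; rewrite -E map_f in ys.
by rewrite ifN ?IHs //; apply: contraNneq ys => ->; apply: map_f.
Qed.

Section Decomposition.
Variables (k : nat) (X : choiceType) (col : X -> 'I_k).

Lemma dsum_map_inj (l : dsum_elt col) :
  uniq [seq tag z | z <- l] -> lie_ideal (dsum_map l) ->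
  forall z, z \in l -> lie_ideal (tagged z).
Proof.
move=> ul lI z zl.
(* A default element of [X] is required; any monomial of a nonzero component supplies one. *)
case Ed: (dom (tagged z)) => [|t0 d].
  have /eqP -> : tagged z == 0 by rewrite -dom_eq0 Ed.
  exact: li_zero.
have [x0 _] : exists x0 : X, true.
  case: (first_leaf t0) => -[|x0 s] /eqP E; last by exists x0.
  have := lyndon_N0 (valP (tag z)); case: (val (tag z)) E => [//|c u] E _.
  by have := count_block_word (c :: u) c; rewrite -E /= eqxx.
pose c0 := col x0.
(* Large enough for every word occurring in [l] to be eliminated. *)
pose N := (\max_(z <- l) size (val (tag z)))%N.
have [W [sW mW]] := lyndon_enum k N.
have [lazH _] := lyndon_lazard c0 sW mW (esym (cats0 W)).
set H := elim_list c0 W in lazH.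
have tH z' : z' \in l -> ltree c0 (val (tag z')) \in H.
  move=> zl'; rewrite mem_rev; apply: map_f; rewrite mW (valP (tag z')) /=.
  by apply: (leq_bigmax_seq (F := fun z => size (val (tag z)))).
(* Components are grouped by colour, leaving the remainder 0 for [stage_inj]. *)
pose x h := \sum_(z' <- l | ltree c0 (val (tag z')) == h)
   beta_lift x0 (tagged z').
have [|||xI _] := stage_inj (col := col) (H := H) (x := x) (z := 0) lazH.
- move=> h _; rewrite /x; apply: (big_ind (fun y => supp _ y)).
  + exact: supp0.
  + by move=> *; apply: suppD.
  by move=> z' /eqP <-; apply: supp_beta_lift.
- exact: supp0.
- rewrite addr0; suff -> : \sum_(h <- H) x h = \sum_(z' <- l) beta_lift x0 (tagged z').
    rewrite raddf_sum /=; move: lI; congr lie_ideal.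
    by apply: eq_bigr => z' _; rewrite -(flat_beta_lift x0).
  rewrite /x (exchange_big_dep xpredT) //= [LHS]big_seq [RHS]big_seq.
  apply: eq_bigr => z' zl'; rewrite -big_filter.
  rewrite (eq_filter (a2 := pred1 (ltree c0 (val (tag z'))))); last first.
    by move=> h /=; rewrite eq_sym.
  by rewrite filter_pred1_uniq ?lazard_uniq ?tH // big_seq1.
apply: (@beta_lift_ideal _ _ _ x0).
have := xI _ (tH z zl); rewrite /x -big_filter.
(* [ltree] is injective on Lyndon words and the tags are distinct, so only [z] contributes to its
   colour. *)
rewrite (eq_filter (a2 := fun y => tag y == tag z)) ?filter_uniq_map ?big_seq1 //.
move=> y /=; apply/eqP/eqP => [/ltree_inj E|-> //].
by apply: val_inj; apply: E; rewrite -topredE /= (valP (tag _)).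
Qed.

Lemma dsum_map_surj (q : nafree X) :
  exists l : dsum_elt col, lie_ideal (dsum_map l - q).
Proof.
elim/freeg_spanW: q => [|p q [l hl] [m hm]|t].
- by exists [::]; rewrite /dsum_map big_nil subr0; apply: li_zero.
- pose Lu (u : lyndon_word k) := nafree (tensor_basis col (val u)).
  exists (l ++ [seq Tagged Lu (- tagged z) | z : {u & Lu u} <- m]).
  rewrite /dsum_map big_cat /= big_map.
  rewrite [X in _ + X - _](eq_bigr (fun z => - beta_tilde (tagged z))).
    by rewrite sumrN; exact: (liemodB hl hm).
  by move=> z _; rewrite /= /beta_tilde raddfN.
pose x0 := first_leaf t; pose c0 := col x0.
have [W [sW mW]] := lyndon_enum k (nleaves t).
have [lazH alphH] := lyndon_lazard c0 sW mW (esym (cats0 W)).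
have [|x [z [sx sz hz]]] :=
  stage_surj col (n := nleaves t) (q := << t >>) lazH.
  by rewrite supp1.
(* Every monomial of the remainder has the degree of [t], so its letters have at most that many
   leaves; all such letters have been eliminated. *)
have -> : z = 0.
  apply: supp_pred0; apply: sub_supp (suppI sz hz) => s /= /andP[As /eqP ws].
  have [y [Ay yt]] : exists y,
      coltree col (alph (elim_list c0 W)) y /\ (nleaves y <= nleaves t)%N.
    rewrite -ws {ws}; elim: s As => [y|a IHa b _] /= As; first by exists y.
    case/andP: As => /IHa[y [Ay ya]] _; exists y; split=> //.
    exact: leq_trans (leq_addr _ _).
  have [] := (alphH (tmap col y) _).1 Ay => // [|w []//].
  by rewrite -size_leaves leaves_tmap size_map size_leaves.
rewrite addr0 /elim_list (perm_big _ (permEl (perm_rev _))) big_map raddf_sum /= => hI.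
suff [l El] : exists l : dsum_elt col,
    dsum_map l = \sum_(w <- W) flat (x (ltree c0 w)) by exists l; rewrite El.
have: {in W, forall w, lyndon w /\
    supp (tall (coltree col (pred1 (ltree c0 w)))) (x (ltree c0 w))}.
  move=> w wW; split; first by move: wW; rewrite mW => /andP[].
  by apply: sx; rewrite mem_rev map_f.
elim: (W) => [|w V IHV] hV; first by exists [::]; rewrite /dsum_map !big_nil.
have [l El] : exists l : dsum_elt col, dsum_map l = \sum_(w <- V) flat (x (ltree c0 w)).
  by apply: IHV => w' w'V; apply: hV; rewrite in_cons w'V orbT.
have [Lw sxw] := hV w (mem_head _ _).
have [a Ea] := @beta_lift_surj k X col x0 (Sub w Lw) _ sxw.
exists (Tagged (fun u : lyndon_word k => nafree (tensor_basis col (val u))) a :: l).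
by rewrite /dsum_map big_cons -/(dsum_map l) El big_cons -Ea flat_beta_lift.
Qed.

End Decomposition.

(* The map  (+)_u tilde-beta_u : (+)_{m, u in B(m)} Lie[W_u] -> Lie[V]   *)
(* (W_u = V_1^(m_1) ... V_k^(m_k), V = V_1 + ... + V_k) is an            *)
(* isomorphism of abelian groups.  Lie algebras are presented as          *)
(* Z{basis} / lie_ideal; the three conjuncts say that the map is          *)
(* well defined on the quotients, surjective, and injective.              *)
Theorem theorem3p15 (k : nat) (X : choiceType) (col : X -> 'I_k) :
  [/\ (forall (u : lyndon_word k) (a : nafree (tensor_basis col (val u))),
         lie_ideal a -> lie_ideal (@beta_tilde k X col u a)),
      (forall q : nafree X, exists l : dsum_elt col,
         lie_ideal (dsum_map l - q))
    & (forall l : dsum_elt col, uniq [seq tag z | z <- l] ->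
         lie_ideal (dsum_map l) ->
         forall z, z \in l -> lie_ideal (tagged z))].
Proof.
split=> [u a|q|l]; first exact: alg_ext_ideal.
  exact: dsum_map_surj.
exact: dsum_map_inj.
Qed.
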